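(* Let $K_\alpha^{\;\;A}$ ($\alpha=0,\dots,4$, $A=1,\dots,10$) be the ten gauge vector fields of the de Sitter group $SO(1,4)$ on the de Sitter hyperboloid $M=\{x\in\mathbb{R}^5: x\cdot x=-1\}$; they are transverse, $x\cdot K^A=0$. Consider the action $$S[K]=\int d\mu(x)\, \left(R_{\alpha\beta}^{\;\;\;\;A}\,q_{AB}\,R^{\alpha\beta B}\right),\qquad R_{\alpha\beta}^{\;\;\;\;A}=\nabla^\top_\alpha K_\beta^{\;\;A}-\nabla^\top_\beta K_\alpha^{\;\;A}+K_\beta^{\;\;B}K_\alpha^{\;\;C}f_{BC}^{\;\;\;\;A},$$ where $d\mu(x)$ is the de Sitter invariant volume element, $f_{BC}^{\;\;\;\;A}$ are the structure constants of the Lie algebra of $SO(1,4)$, and $q_{AB}$ is a numerical constant. Then the linear (free) field equation obtained from the Euler--Lagrange equation of this action is $$-Q_0 K_{\alpha}^{\;\;A}+2K_{\alpha}^{\;\;A}-x_{\alpha}\,\partial^\top\cdot K^{A}-\partial^\top_\alpha\,\partial^\top\cdot K^{A}=0 .$$ If the fields satisfy the transversality and divergencelessness conditions $$x\cdot K^{A}=0,\qquad \partial^\top\cdot K^{A}=0,$$ then this field equation becomes $$(Q_0-2)\,K_\alpha^{\;\;A}=0 .$$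
   Context: Indices $\alpha,\beta,\dots\in\{0,1,2,3,4\}$ are raised and lowered with $\eta=\mathrm{diag}(1,-1,-1,-1,-1)$, repeated indices are summed, and $u\cdot v=\eta_{\alpha\beta}u^\alpha v^\beta$. The transverse projector is $\theta_{\alpha\beta}=\eta_{\alpha\beta}+x_\alpha x_\beta$, and the transverse derivative is $\partial^\top_\beta=\theta_\beta^{\;\;\alpha}\partial_\alpha=\partial_\beta+x_\beta\,x\cdot\partial$. The divergence is $\partial^\top\cdot K=\partial^{\top\alpha}K_\alpha$. The transverse-covariant derivative of a rank-$l$ tensor field $T$ is $$\nabla^\top_\beta T_{\alpha_1\dots\alpha_l}=\partial^\top_\beta T_{\alpha_1\dots\alpha_l}-\sum_{n=1}^{l}x_{\alpha_n}T_{\alpha_1\dots\alpha_{n-1}\beta\alpha_{n+1}\dots\alpha_l}.$$ The operator $Q_0=-\partial^\top\cdot\partial^\top=-\partial^{\top}_\gamma\partial^{\top\gamma}$ acts componentwise. The generators $X_A$ of $SO(1,4)$ satisfy $[X_A,X_B]=f_{BA}^{\;\;\;\;C}X_C$. The linear (free) field equation is the part of the Euler--Lagrange equation linear in $K$.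
   Formalization: The linear field equation is equivalent to the projection of the displayed equation tangent to M; all five components hold exactly when also ∂ᵀ·K=0 (K=∂ᵀφ with Q₀φ≠0 is a counterexample otherwise). The symmetric part of q is assumed invertible (q=0 gives no equation). *)

(* Defs.v *)
From HB Require Import structures.
From mathcomp Require Import all_boot all_order all_algebra.
From mathcomp Require Import all_classical all_reals all_analysis.

Set Implicit Arguments.
Unset Strict Implicit.
Unset Printing Implicit Defensive.

Import Order.TTheory GRing.Theory Num.Theory.
Import numFieldNormedType.Exports.

Local Open Scope classical_set_scope.
Local Open Scope ring_scope.

(** A point of the ambient R^5 is a row vector [x] with contravariant
    coordinates [x 0 a].  Tensor fields are stored with lower indices, so that
    raising an index [a] multiplies by [eta5 R a]. *)

(* The diagonal entries of the metric diag(1,-1,-1,-1,-1), which is its own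
   inverse. *)
Definition eta5 (R : realType) (a : 'I_5) : R := if a == ord0 then 1 else -1.

Definition mdot (R : realType) (u v : 'rV[R]_5) : R :=
  \sum_(a < 5) eta5 R a * u 0 a * v 0 a.

Definition deSitter (R : realType) : set 'rV[R]_5 := [set x | mdot x x = -1].

Definition xlow (R : realType) (x : 'rV[R]_5) (a : 'I_5) : R :=
  eta5 R a * x 0 a.

(* Both indices down. *)
Definition theta (R : realType) (x : 'rV[R]_5) (a b : 'I_5) : R :=
  (if a == b then eta5 R a else 0) + xlow x a * xlow x b.

(** Fields on the hyperboloid are represented by functions on R^5.  The
    hyperboloid is a closed submanifold, so every smooth field on it is the
    restriction of a smooth function on R^5; and [dT] is tangential, so that
    at points of the hyperboloid it depends only on this restriction. *)

Definition partial (R : realType) (a : 'I_5) (g : 'rV[R]_5 -> R) :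
    'rV[R]_5 -> R :=
  fun x => 'D_(delta_mx 0 a) g x.

(* All iterated partial derivatives exist and are differentiable. *)
Definition smooth (R : realType) (g : 'rV[R]_5 -> R) : Prop :=
  forall (s : seq 'I_5) (x : 'rV[R]_5),
    differentiable (foldr (@partial R) g s) x.

(* Transverse derivative theta_b^a d_a; the inner factor [eta5 R a] raises
   the second index of theta. *)
Definition dT (R : realType) (b : 'I_5) (g : 'rV[R]_5 -> R) :
    'rV[R]_5 -> R :=
  fun x => \sum_(a < 5) theta x b a * eta5 R a * partial a g x.

Definition divT (R : realType) (T : 'I_5 -> 'rV[R]_5 -> R) : 'rV[R]_5 -> R :=
  fun x => \sum_(a < 5) eta5 R a * dT a (T a) x.

Definition Q0 (R : realType) (g : 'rV[R]_5 -> R) : 'rV[R]_5 -> R :=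
  fun x => - \sum_(a < 5) eta5 R a * dT a (dT a g) x.

(* Transverse-covariant derivative of a rank-one field: [nablaT b T a] has
   derivative index [b] and tensor index [a]. *)
Definition nablaT (R : realType) (b : 'I_5) (T : 'I_5 -> 'rV[R]_5 -> R)
    (a : 'I_5) : 'rV[R]_5 -> R :=
  fun x => dT b (T a) x - xlow x a * T b x.

(* [X] is a basis of the Lie algebra so(1,4): ten linearly independent
   solutions of X^T eta + eta X = 0, whose solution space has dimension 10. *)
Definition so14_generators (R : realType) (X : 'I_10 -> 'M[R]_5) : Prop :=
  let h := diag_mx (\row_(a < 5) eta5 R a) in
  (forall A, (X A)^T *m h + h *m X A = 0) /\
  (forall c : 'I_10 -> R, \sum_(A < 10) c A *: X A = 0 -> forall A, c A = 0).

(* [f B A C] stands for f_{BA}^C; note the order of the lower indices. *)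
Definition structure_constants (R : realType) (X : 'I_10 -> 'M[R]_5)
    (f : 'I_10 -> 'I_10 -> 'I_10 -> R) : Prop :=
  forall A B, X A *m X B - X B *m X A = \sum_(C < 10) f B A C *: X C.

(* [K A a x] stands for K_a^A(x). *)
Definition gauge_field (R : realType) := 'I_10 -> 'I_5 -> 'rV[R]_5 -> R.

Definition smooth_field (R : realType) (K : gauge_field R) : Prop :=
  forall A a, smooth (K A a).

Definition transverse (R : realType) (K : gauge_field R) : Prop :=
  forall x, deSitter x -> forall A, \sum_(a < 5) x 0 a * K A a x = 0.

Definition divergenceless (R : realType) (K : gauge_field R) : Prop :=
  forall x, deSitter x -> forall A, divT (K A) x = 0.

(* The hyperboloid is closed in R^5, hence its bounded subsets are relatively
   compact. *)
Definition compactly_supported (R : realType) (K : gauge_field R) : Prop :=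
  exists r : R, forall x, deSitter x -> r < `|x| ->
    forall A a, K A a x = 0.

Definition curvature (R : realType) (f : 'I_10 -> 'I_10 -> 'I_10 -> R)
    (K : gauge_field R) (a b : 'I_5) (A : 'I_10) : 'rV[R]_5 -> R :=
  fun x => nablaT a (K A) b x - nablaT b (K A) a x
    + \sum_(B < 10) \sum_(C < 10) K B b x * K C a x * f B C A.

Definition lagrangian (R : realType) (f : 'I_10 -> 'I_10 -> 'I_10 -> R)
    (q : 'M[R]_10) (K : gauge_field R) : 'rV[R]_5 -> R :=
  fun x => \sum_(a < 5) \sum_(b < 5) \sum_(A < 10) \sum_(B < 10)
    curvature f K a b A x * q A B
      * (eta5 R a * eta5 R b * curvature f K a b B x).

(** Integration over the hyperboloid against the invariant volume element, in
    the global coordinates (t, chi, theta, phi) in R x ]0,pi[ x ]0,pi[ x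
    ]0,2 pi[, where the induced metric is
      dt^2 - cosh(t)^2 (dchi^2 + sin(chi)^2 (dtheta^2 + sin(theta)^2 dphi^2))
    and d mu = sqrt |det g| = cosh(t)^3 sin(chi)^2 sin(theta). *)

Definition cosh (R : realType) (t : R) : R := (expR t + expR (- t)) / 2.
Definition sinh (R : realType) (t : R) : R := (expR t - expR (- t)) / 2.

Definition dS_point (R : realType) (t chi th phi : R) : 'rV[R]_5 :=
  \row_(a < 5) nth 0 [:: sinh t;
                         cosh t * (sin chi * (sin th * cos phi));
                         cosh t * (sin chi * (sin th * sin phi));
                         cosh t * (sin chi * cos th);
                         cosh t * cos chi] a.

Definition dS_integral (R : realType) (F : 'rV[R]_5 -> R) : R :=
  \int[@lebesgue_measure R]_(t in [set: R])
  \int[@lebesgue_measure R]_(chi in `[0, pi])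
  \int[@lebesgue_measure R]_(th in `[0, pi])
  \int[@lebesgue_measure R]_(phi in `[0, 2 * pi])
    (F (dS_point t chi th phi) * (cosh t ^+ 3 * sin chi ^+ 2 * sin th)).

Definition fscale (R : realType) (s : R) (K : gauge_field R) : gauge_field R :=
  fun A a x => s * K A a x.

Definition fadd (R : realType) (K L : gauge_field R) : gauge_field R :=
  fun A a x => K A a x + L A a x.

(* S[L] - S[K] for fields which differ on a compact set only.  The two
   Lagrangians are subtracted under the integral because the action of a
   single field over the whole hyperboloid need not be finite. *)
Definition action_diff (R : realType) (f : 'I_10 -> 'I_10 -> 'I_10 -> R)
    (q : 'M[R]_10) (L K : gauge_field R) : R :=
  dS_integral (fun x => lagrangian f q L x - lagrangian f q K x).

(* delta S[K](dK) = d/de S[K + e dK] at e = 0; K satisfies the full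
   Euler-Lagrange equation when this vanishes for every admissible dK. *)
Definition first_variation (R : realType) (f : 'I_10 -> 'I_10 -> 'I_10 -> R)
    (q : 'M[R]_10) (K dK : gauge_field R) : R :=
  derive1 (fun e : R => action_diff f q (fadd K (fscale e dK)) K) 0.

(* The variations are those of the space of fields: smooth and transverse,
   with compact support. *)
Definition admissible_variation (R : realType) (dK : gauge_field R) : Prop :=
  [/\ smooth_field dK, transverse dK & compactly_supported dK].

(* The first variation is a cubic polynomial in K without constant term; its
   homogeneous component of degree one is d/ds delta S[s K](dK) at s = 0. *)
Definition linear_field_equation (R : realType)
    (f : 'I_10 -> 'I_10 -> 'I_10 -> R) (q : 'M[R]_10) (K : gauge_field R) :
    Prop :=
  forall dK, admissible_variation dK ->
    is_derive (0 : R) 1 (fun s : R => first_variation f q (fscale s K) dK) 0.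

(* - Q0 K_a^A + 2 K_a^A - x_a divT K^A - dT_a divT K^A *)
Definition field_expr (R : realType) (K : gauge_field R) (A : 'I_10)
    (a : 'I_5) : 'rV[R]_5 -> R :=
  fun x => - Q0 (K A a) x + 2 * K A a x - xlow x a * divT (K A) x
           - dT a (divT (K A)) x.

(* Main.v *)
Require Import Defs.
From HB Require Import structures.
From mathcomp Require Import all_boot all_order all_algebra.
From mathcomp Require Import ring lra.
From mathcomp Require Import all_classical all_reals all_analysis.

Set Implicit Arguments.
Unset Strict Implicit.
Unset Printing Implicit Defensive.

Import Order.TTheory GRing.Theory Num.Theory.
Import numFieldNormedType.Exports.

Local Open Scope classical_set_scope.
Local Open Scope ring_scope.

(** In the global coordinates, [sqrt |g|] times a transverse divergence is a sum
    of coordinate derivatives whose fluxes vanish at the ends of the coordinate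
    ranges, so that the integral of [dT a g] is [-4] times that of [x_a g] for
    compactly supported [g].  The action is polynomial in [K] and [dK], and its
    part bilinear in both is the integral of [F(K)^ab F(dK)_ab] contracted with
    [q + q^T], where [F] is the abelian field strength.  Since [x^a F_ab = 0] and
    [F] is antisymmetric, integration by parts turns it into [-2] times the
    integral of [dK^b] against the divergence [d^a F_ab], which is [field_expr]
    up to a multiple of [x_b]; the commutator
    [dT_a dT_b - dT_b dT_a = x_b dT_a - x_a dT_b] enters here.  Testing against
    a smooth cutoff times the projected expression itself and inverting
    [q + q^T] gives the first equivalence.  The remaining statements follow from
    the contraction [x^a field_expr_a = - divT K], a consequence of [x.K = 0]. *)

(** * Parametric integrals over a segment *)

(** Fields are functions on R^5, while every constraint on them holds on the hyperboloid only. A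
    constraint can therefore be differentiated only through [dT], and only once [dT] is known to see
    nothing but the restriction; this is shown by differentiating along explicit curves inside the
    hyperboloid. The constant 4 is the trace of [theta], the dimension of the hyperboloid: there
    [dT^c (g theta_ca) = dT_a g + 4 x_a g], the divergence of a tangent field. The invariant
    integral is iterated, and the order of integration is never exchanged: a derivative in an outer
    coordinate crosses the inner integrals by differentiation under the integral sign, which
    continuity on compact ranges permits. Only the variation has compact support, so the action
    difference is expanded into coefficients that each contain a factor from the variation before
    its integral is split. A transverse variation cannot see the radial part of an equation, hence
    the projection by [theta] in the first equivalence and the separate divergence condition in the
    second. *)

Section interval_integrals.
Context {R : realType}.
Implicit Types (a b : R) (f : R -> R).

Let mu := @lebesgue_measure R.

Definition itvI a b f : R := \int[@lebesgue_measure R]_(x in `[a, b]) f x.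

Lemma itv_integrable a b f : continuous f ->
  (@lebesgue_measure R).-integrable `[a, b] (EFin \o f).
Proof.
move=> cf; apply: continuous_compact_integrable; first exact: segment_compact.
exact: continuous_subspaceT.
Qed.

Lemma eq_itvI a b f g : (forall x, a <= x <= b -> f x = g x) ->
  itvI a b f = itvI a b g.
Proof.
by move=> fg; apply: eq_Rintegral => x; rewrite inE/= in_itv/= => /fg.
Qed.

Lemma itvID a b f g : continuous f -> continuous g ->
  itvI a b (fun x => f x + g x) = itvI a b f + itvI a b g.
Proof. by move=> cf cg; apply: RintegralD => //; exact: itv_integrable. Qed.

Lemma itvIZ a b f (k : R) : continuous f ->
  itvI a b (fun x => k * f x) = k * itvI a b f.
Proof. by move=> cf; apply: RintegralZl => //; exact: itv_integrable. Qed.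

Lemma itvI_ge0 a b f : (forall x, a <= x <= b -> 0 <= f x) -> 0 <= itvI a b f.
Proof. by move=> f0; apply: Rintegral_ge0 => x/=; rewrite in_itv/=; exact: f0. Qed.

Lemma itvI0 a b : itvI a b (fun=> 0) = 0.
Proof. by rewrite /itvI /Rintegral integral0. Qed.

Lemma itvI_FTC a b (f g : R -> R) : a < b ->
  (forall x : R, is_derive x (1 : R) f (g x)) -> continuous g ->
  itvI a b g = f b - f a.
Proof.
move=> ab df cg.
have cf : continuous f.
  by move=> x; apply/differentiable_continuous/derivable1_diffP/ex_derive.
rewrite /itvI /Rintegral (@continuous_FTC2 _ g f) //.
- exact: continuous_subspaceT.
- split.
  + by move=> x _; apply: ex_derive.
  + exact/cvg_at_right_filter/cf.
  + exact/cvg_at_left_filter/cf.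
- by move=> x _; rewrite derive1E; exact: derive_val.
Qed.

Lemma itvI_norm_le a b f (e : R) : a <= b -> continuous f ->
  (forall x, a <= x <= b -> `|f x| <= e) -> `|itvI a b f| <= e * (b - a).
Proof.
move=> ab cf fe; apply: (le_trans (le_normr_Rintegral _ _)) => //.
  exact: itv_integrable.
have -> : e * (b - a) = itvI a b (fun=> e).
  rewrite /itvI Rintegral_cst//= lebesgue_measure_itv/= lte_fin.
  by case: ltgtP ab => // -> _; rewrite subrr.
apply: le_Rintegral => //.
  by apply: itv_integrable => x; apply: cvg_norm; exact: cf.
by apply: itv_integrable => x; exact: cvg_cst.
Qed.

Lemma continuous_slice (T : topologicalType) (F : T -> R -> R) x :
  continuous (fun z : T * R => F z.1 z.2) -> continuous (F x).
Proof.
move=> cF y.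
apply: (@continuous_comp _ _ _ (fun y => (x, y)) (fun z : T * R => F z.1 z.2)).
  exact: (cvg_pair (cvg_cst x) cvg_id).
exact: cF.
Qed.

(** Compactness of the segment turns joint continuity at each [(x0, y)] into a single neighbourhood
    of [x0] on which the integrands are uniformly close. *)
Lemma itvI_continuous (T : topologicalType) a b (F : T -> R -> R) : a <= b ->
  continuous (fun z : T * R => F z.1 z.2) -> continuous (fun x => itvI a b (F x)).
Proof.
move=> ab cF x0.
have cFx x : continuous (F x).
  exact: continuous_slice.
apply/cvgrPdist_le => e e0.
(* The [+ 1] keeps the denominator positive when [a = b]. *)
pose d := e / (b - a + 1).
have d0 : 0 < d by rewrite divr_gt0// ltr_wpDl// subr_ge0.
have near_d : \forall x \near x0, forall y, a <= y <= b -> `|F x0 y - F x y| <= d.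
  have /compact_near_coveringP cpt := @segment_compact R a b.
  have H : forall y, y \in `[a, b] -> \forall y' \near y & x \near x0, `|F x0 y' - F x y'| <= d.
    move=> y _.
    have d20 : 0 < d / 2 by rewrite divr_gt0.
    have /cvgrPdist_le/(_ _ d20) [[A B] /= [nA nB] AB] := cF (x0, y).
    exists (B, A) => // -[y' x] /= [By' Ax].
    have h1 := AB (x, y') (conj Ax By').
    have h2 := AB (x0, y') (conj (nbhs_singleton nA) By').
    rewrite /= in h1 h2.
    have -> : F x0 y' - F x y' = (F x0 y - F x y') - (F x0 y - F x0 y') by ring.
    by rewrite (le_trans (ler_normB _ _))// (splitr d) lerD.
  have := cpt T (nbhs x0) (fun x y => `|F x0 y - F x y| <= d) (nbhs_filter x0) H.
  apply: (@filterS _ (nbhs x0)) => x Hx y yab.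
  by apply: Hx; rewrite /= in_itv.
move: near_d; apply: filterS => x Hx.
have -> : itvI a b (F x0) - itvI a b (F x) = itvI a b (fun y => F x0 y - F x y).
  by rewrite /itvI RintegralB//; exact: itv_integrable.
apply: (@le_trans _ _ (d * (b - a))).
  apply: itvI_norm_le => // y.
  by apply: cvgB; exact: cFx.
rewrite /d mulrAC ler_pdivrMr ?ltr_wpDl ?subr_ge0// ler_pM2l//.
by rewrite lerDl.
Qed.

(** Domination is by a constant: [G] is bounded on the compact rectangle over [[s - 1, s + 1]] and
    [[a, b]], and a constant is integrable on a segment. *)
Lemma is_derive_itvI a b (F G : R -> R -> R) (s : R) : a <= b ->
  (forall s, continuous (F s)) ->
  (forall s y : R, is_derive s (1 : R) (F ^~ y) (G s y)) ->
  continuous (fun z : R * R => G z.1 z.2) ->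
  is_derive s (1 : R) (fun s => itvI a b (F s)) (itvI a b (G s)).
Proof.
move=> ab cF dF cG.
have cptK : compact (`[s - 1, s + 1] `*` `[a, b] : set (R * R)).
  by apply: compact_setX; exact: segment_compact.
have cpt : compact ((fun z : R * R => G z.1 z.2) @` (`[s - 1, s + 1] `*` `[a, b])).
  by apply: continuous_compact => //; exact: continuous_subspaceT.
have [M [Mr HM]] := compact_bounded cpt.
(* Compactness gives a bound by every number strictly above [M]; the absolute value makes the
   dominating constant nonnegative. *)
pose M1 := `|M| + 1.
have M1M : M < M1 by rewrite (le_lt_trans (ler_norm M))// ltrDl.
have hM u y : u \in `]s - 1, s + 1[ -> y \in `[a, b] -> `|partial1of2 F u y| <= M1.
  rewrite partial1of2E derive_val !in_itv/= => /andP[u1 u2] yab.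
  by apply: (HM _ M1M); exists (u, y) => //=; split; rewrite /= in_itv//= !ltW.
have E1 u y : partial1of2 F u y = G u y.
  by rewrite partial1of2E; exact: derive_val.
have Is : s \in `]s - 1, s + 1[ by rewrite in_itv/= ltrBlDr ltrDl ltr01.
have intM : mu.-integrable `[a, b] (EFin \o (fun=> M1)).
  by apply: itv_integrable => x; exact: cvg_cst.
have H := @cvg_differentiation_under_integral R _ (measurableTypeR R) mu F `[a, b]
  (measurable_itv _) s (s - 1) (s + 1) Is.
have {}H := H (fun u _ => @itv_integrable a b (F u) (cF u))
  (fun u y _ _ => @ex_derive _ _ _ _ _ _ _ (dF u y)) (fun=> M1)
   (fun=> addr_ge0 (normr_ge0 _) ler01) intM.
have {}H := H (fun u y Iu By => hM u y Iu By).
have {}H : h^-1 *: (itvI a b (F (h + s)) - itvI a b (F s)) @[h --> 0^'] --> itvI a b (G s).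
  rewrite (_ : itvI a b (G s) = \int[mu]_(y in `[a, b]) partial1of2 F s y).
    by apply: H => u y Iu By; rewrite E1; exact: hM.
  by apply: eq_Rintegral => y _; rewrite E1.
apply: DeriveDef; last first.
  rewrite -derive1E /derive1; apply/cvg_lim => //.
apply/cvg_ex; exists (itvI a b (G s)).
by under eq_fun do rewrite scaler1.
Qed.

Lemma continuous_eq0_itv a b f : a < b -> continuous f ->
  (forall x, a < x < b -> f x = 0) -> forall x, a <= x <= b -> f x = 0.
Proof.
move=> ab cf fi x /andP[ax xb].
have [->|nxa] := eqVneq x a; last have [->|nxb] := eqVneq x b.
- apply: (@cvg_unique _ _ (f @ a^'+)) => //; first exact/cvg_at_right_filter/cf.
  apply: cvg_near_cst; near=> y; rewrite fi ?eqxx//; apply/andP; split; near: y.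
    exact: nbhs_right_gt.
  exact: nbhs_right_lt.
- apply: (@cvg_unique _ _ (f @ b^'-)) => //; first exact/cvg_at_left_filter/cf.
  apply: cvg_near_cst; near=> y; rewrite fi ?eqxx//; apply/andP; split; near: y.
    exact: nbhs_left_gt.
  exact: nbhs_left_lt.
- by apply: fi; rewrite !lt_neqAle ax xb eq_sym nxa nxb.
Unshelve. all: by end_near. Qed.

(** A positive value at an interior point keeps [f] above half of it on a short segment [[c, d]],
    which contributes a positive amount to the integral; continuity then reaches the end points. *)
Lemma itvI_eq0 a b f : a < b -> continuous f ->
  (forall x, a <= x <= b -> 0 <= f x) -> itvI a b f = 0 ->
  forall x, a <= x <= b -> f x = 0.
Proof.
move=> ab cf f0 I0.
have : forall x, a < x < b -> f x = 0.
  move=> x0 /andP[ax xb].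
  apply/eqP; rewrite -[_ == _]negbK; apply/negP => fx.
  have fx0 : 0 < f x0 by rewrite lt_neqAle eq_sym fx f0// !ltW.
  have f20 : 0 < f x0 / 2 by rewrite divr_gt0.
  have : \forall x \near x0, f x0 / 2 <= f x.
    have /cvgrPdist_le/(_ _ f20) := cf x0; apply: filterS => x.
    by rewrite ler_norml => /andP[_ h]; lra.
  have : \forall x \near x0, a < x < b.
    have : x0 \in `]a, b[ by rewrite in_itv/= ax xb.
    by move/near_in_itvoo; apply: (@filterS _ (nbhs x0)) => x; by rewrite /= in_itv.
  move=> /filterI h /h /nbhs_ballP [e /= e0 he].
  pose c := x0 - e / 2; pose d := x0 + e / 2.
  have cd : c < d by rewrite /c /d; lra.
  have hcd x : c <= x <= d -> (a < x < b) /\ f x0 / 2 <= f x.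
    move=> /andP[cx xd]; apply: he; rewrite /ball/= ltr_norml; rewrite /c /d in cx xd; lra.
  have : itvI a b (fun=> 0) < itvI a b f; last by rewrite itvI0 I0 ltxx.
  rewrite itvI0.
  have [/andP[ac _] _] := hcd c ltac:(rewrite lexx ltW//).
  have [/andP[_ db] _] := hcd d ltac:(rewrite lexx ltW//).
  apply: (@lt_le_trans _ _ (itvI c d (fun=> f x0 / 2))).
    rewrite /itvI Rintegral_cst//= lebesgue_measure_itv/= lte_fin cd/=.
    by rewrite mulr_gt0// subr_gt0.
  apply: (@le_trans _ _ (itvI c d f)).
    apply: le_Rintegral => //.
    - by apply: itv_integrable => x; exact: cvg_cst.
    - exact: itv_integrable.
    - by move=> x /hcd[].
  rewrite /itvI /Rintegral fine_le//.
  - by apply: integrable_fin_num => //; exact: itv_integrable.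
  - by apply: integrable_fin_num => //; exact: itv_integrable.
  apply: ge0_subset_integral => //.
  - have := itv_integrable a b cf => /(@measurable_int _ _ _ mu); exact.
  - by apply: subset_itv; rewrite bnd_simp ltW.
exact: continuous_eq0_itv.
Qed.

Lemma integral_compact_support f (T : R) :
  (forall t, T < `|t| -> f t = 0) ->
  \int[@lebesgue_measure R]_(t in [set: R]) f t = itvI (- T) T f.
Proof.
move=> f0; rewrite /itvI [RHS]Rintegral_mkcond; apply: eq_Rintegral => t _.
rewrite patchE; case: ifPn => //; rewrite notin_setE/= in_itv/= -ler_norml.
by move=> /negP; rewrite -ltNge; exact: f0.
Qed.

End interval_integrals.

(** * Smooth functions on R^5 *)

Section smooth_functions.
Context {R : realType}.
Local Notation V := 'rV[R]_5.
Implicit Types (g h : V -> R) (x : V).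

Lemma smooth_diff g x : smooth g -> differentiable g x.
Proof. by move=> /(_ [::] x). Qed.

Lemma smooth_partial a g : smooth g -> smooth (partial a g).
Proof. by move=> gs s x; have := gs (rcons s a) x; rewrite foldr_rcons. Qed.

Lemma smooth_continuous g : smooth g -> continuous g.
Proof. by move=> gs x; exact/differentiable_continuous/smooth_diff. Qed.

Lemma derive_sum_partial g x (v : V) : differentiable g x ->
  'D_v g x = \sum_a v 0 a * partial a g x.
Proof.
move=> dg; rewrite deriveE// {1}(row_sum_delta v) linear_sum/=.
by apply: eq_bigr => a _; rewrite linearZ/= /partial deriveE.
Qed.

Lemma is_derive_curve g (c : R -> V) (d : 'I_5 -> R) (s : R) :
  (forall a, is_derive s (1 : R) (fun u => c u 0 a) (d a)) ->
  differentiable g (c s) ->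
  is_derive s (1 : R) (g \o c) (\sum_a d a * partial a g (c s)).
Proof.
move=> dc dg.
have derc : derivable c s 1.
  by apply/derivable_mxP => i a; rewrite (ord1 i); exact: ex_derive.
have difc : differentiable c s by exact/derivable1_diffP.
have difgc : differentiable (g \o c) s by exact: differentiable_comp.
apply: DeriveDef; first exact/derivable1_diffP.
rewrite deriveE// diff_comp//= -!deriveE// derive_sum_partial//.
by apply: eq_bigr => a _; rewrite derive_mx// mxE derive_val.
Qed.

Lemma continuous_row (T : topologicalType) (c : T -> V) :
  (forall a, continuous (fun z => c z 0 a)) -> continuous c.
Proof.
move=> cc.
have -> : c = fun z => \sum_a c z 0 a *: delta_mx 0 a.
  by apply/funext => z; rewrite -row_sum_delta.
apply: continuous_big => [|a _]; first exact: add_continuous.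
by move=> z; apply: cvgZr_tmp; exact: cc.
Qed.

Lemma partialD a g h x : differentiable g x -> differentiable h x ->
  partial a (fun y => g y + h y) x = partial a g x + partial a h x.
Proof. by move=> dg dh; apply: deriveD; exact: diff_derivable. Qed.

Lemma partialM a g h x : differentiable g x -> differentiable h x ->
  partial a (fun y => g y * h y) x = g x * partial a h x + h x * partial a g x.
Proof. by move=> dg dh; apply: deriveM; exact: diff_derivable. Qed.

Lemma partial_cst a (k : R) x : partial a (fun=> k) x = 0.
Proof. exact: derive_cst. Qed.

Lemma partial_coord a b x : partial a (fun y => y 0 b) x = (a == b)%:R.
Proof.
have := congr1 (fun M : 'rV[R]_5 => M 0 b)
  (derive_mx (@derivable_id R V x (delta_mx 0 a))).
by rewrite derive_id !mxE eqxx eq_sym => ->.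
Qed.

(* Differentiating [g(s, t) - g(-1, t)], the integral of the first partial
   derivative, in [t] under the integral sign and then in [s]. *)
Lemma partial_comm a b g x : smooth g ->
  partial a (partial b g) x = partial b (partial a g) x.
Proof.
move=> gs.
pose p (s t : R) : V := x + s *: delta_mx 0 a + t *: delta_mx 0 b.
have pE s t c : p s t 0 c = x 0 c + s * (c == a)%:R + t * (c == b)%:R.
  by rewrite !mxE.
have cp : continuous (fun z : R * R => p z.1 z.2).
  apply: continuous_row => c.
  under eq_fun do rewrite pE.
  move=> z; apply: cvgD; first (apply: cvgD; first exact: cvg_cst).
    by apply: cvgM; [exact: cvg_fst|exact: cvg_cst].
  by apply: cvgM; [exact: cvg_snd|exact: cvg_cst].
have cp2 h : smooth h -> continuous (fun z : R * R => h (p z.1 z.2)).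
  by move=> hs z; apply: continuous_comp; [exact: cp|exact: smooth_continuous].
have ds h s t : smooth h ->
    is_derive s (1 : R) (fun s => h (p s t)) (partial a h (p s t)).
  move=> hs.
  suff : is_derive s (1 : R) (fun s => h (p s t))
      (\sum_c (c == a)%:R * partial c h (p s t)).
    rewrite (bigD1 a)//= big1 ?addr0 ?eqxx ?mul1r// => c /negbTE ->.
    by rewrite mul0r.
  apply: (@is_derive_curve h (p ^~ t)); last exact: smooth_diff.
  move=> c; under eq_fun do rewrite pE.
  by apply: is_derive_eq; rewrite /GRing.scale/=; ring.
have dt h s t : smooth h ->
    is_derive t (1 : R) (fun t => h (p s t)) (partial b h (p s t)).
  move=> hs.
  suff : is_derive t (1 : R) (fun t => h (p s t))
      (\sum_c (c == b)%:R * partial c h (p s t)).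
    rewrite (bigD1 b)//= big1 ?addr0 ?eqxx ?mul1r// => c /negbTE ->.
    by rewrite mul0r.
  apply: (@is_derive_curve h (p s)); last exact: smooth_diff.
  move=> c; under eq_fun do rewrite pE.
  by apply: is_derive_eq; rewrite /GRing.scale/=; ring.
have gas := smooth_partial a gs; have gbs := smooth_partial b gs.
have gbas := smooth_partial b gas.
have c1 h t : smooth h -> continuous (fun s => h (p s t)).
  move=> hs s; have d := ds h s t hs.
  apply: differentiable_continuous; apply/derivable1_diffP.
  exact: (@ex_derive _ _ _ _ _ _ _ d).
(* The base point [-1] is arbitrary: it only has to lie to the left of [0], so that the identity
   holds in a neighbourhood of [0]. *)
have E (s : R) : -1 < s -> partial b g (p s 0) - partial b g (p (-1) 0) =
    itvI (-1) s (fun u => partial b (partial a g) (p u 0)).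
  move=> s1.
  have H : (fun t => itvI (-1) s (fun u => partial a g (p u t))) =
      (fun t => g (p s t) - g (p (-1) t)).
    apply/funext => t.
    exact: (itvI_FTC s1 (fun u => ds g u t gs) (c1 _ t gas)).
  have := @is_derive_itvI _ (-1) s (fun t u => partial a g (p u t))
    (fun t u => partial b (partial a g) (p u t)) 0 (ltW s1) _ _ _.
  move=> /(_ (fun t => c1 _ t gas) (fun t u => dt _ u t gas)) H2.
  have {H2} /(@derive_val _ _ _ _ _ _ _) : is_derive (0 : R) (1 : R)
      (fun t => itvI (-1) s (fun u => partial a g (p u t)))
      (itvI (-1) s (fun u => partial b (partial a g) (p u 0))).
    apply: H2 => z.
    apply: (@continuous_comp _ _ _ (fun z : R * R => (z.2, z.1))
      (fun z : R * R => partial b (partial a g) (p z.1 z.2))); last exact: cp2.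
    exact: (cvg_pair cvg_snd cvg_fst).
  rewrite H => <-.
  have d1 := dt _ s 0 gs; have d2 := dt _ (-1) 0 gs.
  exact: (esym (@derive_val _ _ _ _ _ _ _ (is_deriveB d1 d2))).
have := @continuous_FTC1_closed _ (fun u => partial b (partial a g) (p u 0)) (-1) 0 1
  ltr01 (itv_integrable _ _ (c1 _ 0 gbas)).
have c0 : -1 < 0 :> R by rewrite ltrN10.
move=> /(_ c0 (c1 _ 0 gbas 0)) [_].
rewrite derive1E.
have p00 : p 0 0 = x by rewrite /p !scale0r !addr0.
rewrite p00 => <-.
have d0 := ds _ 0 0 gbs; rewrite p00 in d0.
have := is_deriveB d0 (is_derive_cst (partial b g (p (-1) 0)) (0 : R) (1 : R)).
rewrite subr0 => /(@derive_val _ _ _ _ _ _ _) <-.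
apply: near_eq_derive.
have : (0 : R) \in `]-1, 1[ by rewrite in_itv/= ltrN10 ltr01.
move/near_in_itvoo; apply: (@filterS _ (nbhs (0 : R))) => s /=.
rewrite in_itv/= => /andP[s1 _].
by rewrite -[RHS]E.
Qed.

End smooth_functions.

(** * Closure properties of smooth functions, and a flat function for cutoffs *)

Section smooth_closure.
Context {R : realType}.
Local Notation V := 'rV[R]_5.
Implicit Types (g h : V -> R) (x : V) (P : {poly R}).

(** The [n]-th power of [w <= 1 + w <= exp w] at [w = v / n]. *)
Lemma expn_le_expR (n : nat) (v : R) : 0 <= v -> v ^+ n <= n%:R ^+ n * expR v.
Proof.
move=> v0; case: n => [|n]; first by rewrite !expr0 mul1r -expR0 ler_expR.
have n0 : 0 < n.+1%:R :> R by rewrite ltr0n.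
have w0 : 0 <= v / n.+1%:R by rewrite divr_ge0.
have -> : v = n.+1%:R * (v / n.+1%:R) by rewrite mulrCA divff ?mulr1// gt_eqF.
rewrite exprMn expRM_natl ler_pM2l ?exprn_gt0// lerXn2r ?nnegrE ?expR_ge0//.
by rewrite (le_trans _ (expR_ge1Dx _))// lerDr.
Qed.

Lemma horner_le_expR P : exists2 C, 0 <= C &
  forall v : R, 0 <= v -> `|P.[v]| <= C * expR v.
Proof.
exists (\sum_(i < size P) `|P`_i| * i%:R ^+ i).
  by apply: sumr_ge0 => i _; rewrite mulr_ge0// exprn_ge0.
move=> v v0; rewrite horner_coef mulr_suml.
apply: (le_trans (ler_norm_sum _ _ _)); apply: ler_sum => i _.
rewrite normrM -mulrA ler_wpM2l// ger0_norm ?exprn_ge0//.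
exact: expn_le_expR.
Qed.

(* The functions [P(1/u) exp(-1/u)] extended by zero are closed under
   differentiation, which makes each of them smooth. *)
Definition hexp P (u : R) : R := if 0 < u then P.[u^-1] * expR (- u^-1) else 0.

(** Applying the exponential bound to [X^2 P] at [1 / u] leaves a spare factor [u^2], which is what
    gives derivative zero at the origin. *)
Lemma hexp_quadratic P : exists2 C, 0 <= C & forall u, `|hexp P u| <= C * u ^+ 2.
Proof.
have [C C0 HC] := horner_le_expR ('X^2 * P); exists C => // u.
rewrite /hexp; case: ifPn => [u0|_]; last by rewrite normr0 mulr_ge0// sqr_ge0.
have v0 : 0 <= u^-1 by rewrite invr_ge0 ltW.
have := HC _ v0; rewrite hornerM hornerXn => H.
have E0 := expR_gt0 u^-1.
rewrite expRN normrM (ger0_norm (_ : 0 <= (expR u^-1)^-1)) ?invr_ge0 ?expR_ge0//.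
rewrite ler_pdivrMr// mulrAC -ler_pdivrMr ?exprn_gt0//.
by move: H; rewrite normrM ger0_norm ?sqr_ge0// exprVn mulrC.
Qed.

(** For [u > 0] both factors bring down [u^-2], recorded by [X^2]: the term [P] comes from the
    exponential, the negative derivative of [P] from the polynomial. *)
Lemma is_derive_hexp P (u : R) :
  is_derive u (1 : R) (hexp P) (hexp ('X^2 * (P - P^`())) u).
Proof.
have [u0|u0|->] := ltgtP u 0.
- rewrite {2}/hexp ltNge (ltW u0)/=.
  apply: (@near_eq_is_derive _ _ _ (cst 0)).
  near=> w; rewrite /hexp ltNge; have /ltW -> // : w < 0.
  by near: w; exact: lt_nbhsl.
- rewrite {2}/hexp u0.
  apply: (@near_eq_is_derive R R R (fun w : R => P.[w^-1] * expR (- w^-1))).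
    near=> w; rewrite /hexp; have -> // : 0 < w by near: w; exact: lt_nbhsr.
  have un0 : u != 0 by rewrite gt_eqF.
  have dV : is_derive u (1 : R) (fun w : R => w^-1) (- u ^- 2).
    have := @is_deriveV R (fun w : R => w) u 1 1 un0 (is_derive_id _ _).
    by rewrite /GRing.scale/= mulr1.
  have d1 : is_derive u (1 : R) (fun w : R => P.[w^-1]) (P^`().[u^-1] * (- u ^- 2)).
    exact: (@is_derive1_comp _ (horner P) (fun w : R => w^-1)).
  have dN : is_derive u (1 : R) (fun w : R => - w^-1) (u ^- 2).
    by apply: is_derive_eq; rewrite opprK.
  have d2 : is_derive u (1 : R) (fun w : R => expR (- w^-1)) (expR (- u^-1) * u ^- 2).
    exact: (@is_derive1_comp _ (@expR R) (fun w : R => - w^-1)).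
  apply: is_derive_eq; rewrite /GRing.scale/= hornerM hornerXn hornerD hornerN exprVn; ring.
(* At the origin the difference quotient is at most [C |h|] in absolute value. *)
- rewrite {2}/hexp ltxx.
  have [C C0 HC] := hexp_quadratic P.
  have H : h^-1 *: (hexp P (h *: 1 + 0) - hexp P 0) @[h --> 0^'] --> (0 : R).
    have h0 : hexp P 0 = 0 by rewrite /hexp ltxx.
    under eq_fun do rewrite h0 subr0 addr0 /GRing.scale/= mulr1.
    apply/cvgr0Pnorm_le => e e0.
    have C1 : 0 < C + 1 by rewrite ltr_wpDl.
    near=> h.
    have hn0 : h != 0 by near: h; exact: nbhs_dnbhs_neq.
    rewrite normrM normfV ler_pdivrMl ?normr_gt0//.
    apply: (le_trans (HC h)).
    have hle : `|h| <= e / (C + 1).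
      by near: h; apply: dnbhs0_le; rewrite divr_gt0.
    rewrite -real_normK ?num_real// expr2 mulrCA ler_pM2l ?normr_gt0//.
    apply: (@le_trans _ _ (C * (e / (C + 1)))); first exact: ler_wpM2l.
    by rewrite mulrCA ler_piMr ?ltW// ltr_pdivrMr// mul1r ltrDl.
  apply: DeriveDef; first by apply/cvg_ex; exists 0.
  exact/cvg_lim.
Unshelve. all: by end_near. Qed.

(** Smoothness quantifies over all iterated derivatives, which a product or a composition does not
    expose. This class is closed under [partial] by one structural induction and consists of
    differentiable functions, so its members are smooth. *)
Inductive smooth_gen : (V -> R) -> Prop :=
| sg_base g : smooth g -> smooth_gen g
| sg_cst (k : R) : smooth_gen (fun=> k)
| sg_coord a : smooth_gen (fun x => x 0 a)
| sg_add g h : smooth_gen g -> smooth_gen h -> smooth_gen (fun x => g x + h x)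
| sg_mul g h : smooth_gen g -> smooth_gen h -> smooth_gen (fun x => g x * h x)
| sg_hexp P g : smooth_gen g -> smooth_gen (fun x => hexp P (g x)).

Lemma smooth_gen_diff g : smooth_gen g -> forall x, differentiable g x.
Proof.
elim=> {g} [g gs x|k x|a x|g h _ gd _ hd x|g h _ gd _ hd x|P g _ gd x].
- exact: smooth_diff.
- exact: differentiable_cst.
- exact: differentiable_coord.
- exact: differentiableD.
- exact: differentiableM.
- apply: (@differentiable_comp _ _ _ _ g (hexp P)) => //.
  by apply/derivable1_diffP/ex_derive/is_derive_hexp.
Qed.

Lemma partial_hexp P g a x : differentiable g x ->
  partial a (fun x => hexp P (g x)) x =
  hexp ('X^2 * (P - P^`())) (g x) * partial a g x.
Proof.
move=> dg; have dh := is_derive_hexp P (g x).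
have dP : differentiable (hexp P) (g x) by apply/derivable1_diffP; exact: ex_derive.
have dc : differentiable (hexp P \o g) x by exact: differentiable_comp.
rewrite /partial deriveE// (@diff_comp _ _ _ _ g (hexp P))//=.
rewrite deriv1E; last exact: ex_derive.
by rewrite derive1E derive_val -deriveE// /GRing.scale/= mulrC.
Qed.

Lemma smooth_gen_partial g : smooth_gen g -> forall a, smooth_gen (partial a g).
Proof.
elim=> {g} [g gs a|k a|b a|g h gs gd hs hd a|g h gs gd hs hd a|P g gs gd a].
- by apply: sg_base; exact: smooth_partial.
- rewrite (_ : partial a _ = fun=> 0); first exact: sg_cst.
  by apply/funext => x; exact: partial_cst.
- rewrite (_ : partial a _ = fun=> (a == b)%:R); first exact: sg_cst.
  by apply/funext => x; exact: partial_coord.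
- rewrite (_ : partial a _ = fun x => partial a g x + partial a h x).
    exact: sg_add.
  by apply/funext => x; apply: partialD; exact: smooth_gen_diff.
- rewrite (_ : partial a _ =
      fun x => g x * partial a h x + h x * partial a g x).
    by apply: sg_add; exact: sg_mul.
  by apply/funext => x; apply: partialM; exact: smooth_gen_diff.
- rewrite (_ : partial a _ =
      fun x => hexp ('X^2 * (P - P^`())) (g x) * partial a g x).
    by apply: sg_mul => //; exact: sg_hexp.
  by apply/funext => x; apply: partial_hexp; exact: smooth_gen_diff.
Qed.

Lemma smooth_gen_smooth g : smooth_gen g -> smooth g.
Proof.
move=> gs s; suff : smooth_gen (foldr (@partial R) g s) by exact: smooth_gen_diff.
by elim: s => //= a s ?; exact: smooth_gen_partial.
Qed.

Lemma smooth_cst (k : R) : smooth (fun _ : V => k).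
Proof. exact/smooth_gen_smooth/sg_cst. Qed.

Lemma smooth_coord a : smooth (fun x : V => x 0 a).
Proof. exact/smooth_gen_smooth/sg_coord. Qed.

Lemma smoothD g h : smooth g -> smooth h -> smooth (fun x => g x + h x).
Proof. by move=> ? ?; apply/smooth_gen_smooth/sg_add; exact: sg_base. Qed.

Lemma smoothM g h : smooth g -> smooth h -> smooth (fun x => g x * h x).
Proof. by move=> ? ?; apply/smooth_gen_smooth/sg_mul; exact: sg_base. Qed.

Lemma smooth_hexp P g : smooth g -> smooth (fun x => hexp P (g x)).
Proof. by move=> ?; apply/smooth_gen_smooth/sg_hexp; exact: sg_base. Qed.

Lemma smoothN g : smooth g -> smooth (fun x => - g x).
Proof.
move=> gs; rewrite (_ : (fun x => _) = fun x => -1 * g x).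
  by apply: smoothM => //; exact: smooth_cst.
by apply/funext => x; rewrite mulN1r.
Qed.

Lemma smoothB g h : smooth g -> smooth h -> smooth (fun x => g x - h x).
Proof. by move=> gs hs; apply: smoothD => //; exact: smoothN. Qed.

Lemma smooth_sum (I : finType) (F : I -> V -> R) : (forall i, smooth (F i)) ->
  smooth (fun x => \sum_i F i x).
Proof.
move=> Fs; elim: (index_enum I) => [|i r IH].
  by under eq_fun do rewrite big_nil; exact: smooth_cst.
by under eq_fun do rewrite big_cons; exact: smoothD.
Qed.

Lemma smooth_xlow a : smooth (fun x : V => xlow x a).
Proof. by apply: smoothM; [exact: smooth_cst|exact: smooth_coord]. Qed.

Lemma smooth_theta a b : smooth (fun x : V => theta x a b).
Proof.
by apply: smoothD; [exact: smooth_cst|apply: smoothM; exact: smooth_xlow].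
Qed.

Lemma smooth_dT a g : smooth g -> smooth (dT a g).
Proof.
move=> gs; apply: smooth_sum => b; apply: smoothM; last exact: smooth_partial.
by apply: smoothM; [exact: smooth_theta|exact: smooth_cst].
Qed.

Lemma smooth_divT (T : 'I_5 -> V -> R) : (forall a, smooth (T a)) ->
  smooth (divT T).
Proof.
move=> Ts; apply: smooth_sum => a; apply: smoothM; first exact: smooth_cst.
exact: smooth_dT.
Qed.

Lemma smooth_Q0 g : smooth g -> smooth (Q0 g).
Proof.
move=> gs; apply/smoothN/smooth_sum => a; apply: smoothM; first exact: smooth_cst.
exact/smooth_dT/smooth_dT.
Qed.

Lemma smooth_field_expr (K : gauge_field R) A a : smooth_field K ->
  smooth (field_expr K A a).
Proof.
move=> Ks; have ds : smooth (divT (K A)) by apply: smooth_divT => b; exact: Ks.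
apply: smoothB; last exact: smooth_dT.
apply: smoothB; last by apply: smoothM; [exact: smooth_xlow|].
apply: smoothD; first exact/smoothN/smooth_Q0/Ks.
by apply: smoothM; [exact: smooth_cst|exact: Ks].
Qed.

End smooth_closure.

(** * Transverse derivatives *)

Section transverse_calculus.
Context {R : realType}.
Local Notation V := 'rV[R]_5.
Local Notation e := (eta5 R).
Implicit Types (g h : V -> R) (x : V).

Lemma eta5_sqr a : e a * e a = 1.
Proof. by rewrite /eta5; case: ifP; rewrite ?mulrNN mulr1. Qed.

Lemma theta_sym x a b : theta x a b = theta x b a.
Proof.
by rewrite /theta eq_sym mulrC; case: eqVneq => // ->.
Qed.

Lemma sum_delta_eta (F : 'I_5 -> R) a :
  \sum_b e b * (if a == b then e a else 0) * F b = F a.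
Proof.
rewrite (bigD1 a)//= eqxx eta5_sqr mul1r big1 ?addr0// => b.
by rewrite eq_sym => /negbTE ->; rewrite mulr0 mul0r.
Qed.

Lemma sum_theta (F : 'I_5 -> R) x a :
  \sum_b e b * theta x a b * F b = F a + xlow x a * \sum_b x 0 b * F b.
Proof.
rewrite -[F a in RHS](sum_delta_eta F a) mulr_sumr -big_split/=.
apply: eq_bigr => b _; rewrite /theta mulrDr mulrDl; congr (_ + _).
rewrite {2}/xlow.
transitivity ((e b * e b) * (xlow x a * (x 0 b * F b))); first by ring.
by rewrite eta5_sqr mul1r.
Qed.

Lemma sum_x_xlow x : deSitter x -> \sum_a x 0 a * xlow x a = -1.
Proof.
by move=> <-; apply: eq_bigr => a _; rewrite /xlow; ring.
Qed.

Lemma sum_x_theta x b : deSitter x -> \sum_a x 0 a * theta x b a = 0.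
Proof.
move=> xS; transitivity (\sum_a e a * theta x b a * xlow x a).
  apply: eq_bigr => a _; rewrite /xlow.
  by transitivity (e a * e a * (x 0 a * theta x b a)); [rewrite eta5_sqr mul1r|ring].
by rewrite sum_theta sum_x_xlow// mulrN1 subrr.
Qed.

Lemma sum_x_dT g x : deSitter x -> \sum_a x 0 a * dT a g x = 0.
Proof.
move=> xS; rewrite /dT.
under eq_bigr do rewrite mulr_sumr.
rewrite exchange_big/= big1// => b _.
transitivity ((\sum_a x 0 a * theta x b a) * (e b * partial b g x)).
  by rewrite mulr_suml; apply: eq_bigr => a _; rewrite (theta_sym x a b); ring.
by rewrite sum_x_theta// mul0r.
Qed.

(** The trace is [5 - 1]. In [div_field_strength] it contributes the [4 T_b] that ends up as the
    [2 T_b] of the field equation. *)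
Lemma sum_eta_theta x : deSitter x -> \sum_a e a * theta x a a = 4.
Proof.
move=> xS; have -> : \sum_a e a * theta x a a = \sum_(a < 5) 1 + \sum_a x 0 a * xlow x a.
  rewrite -big_split/=; apply: eq_bigr => a _.
  rewrite /theta eqxx mulrDr eta5_sqr; congr (_ + _).
  by rewrite {1}/xlow mulrA mulrA eta5_sqr mul1r.
by rewrite sum_x_xlow// sumr_const card_ord; ring.
Qed.

(* Rational parametrization of the conic through [x] with tangent direction
   [v], cut out of the hyperboloid by the plane of [x] and [v]. *)
Definition conic x (v : V) (s : R) : V :=
  (1 - s ^+ 2 * mdot v v)^-1 *:
    ((1 + s ^+ 2 * mdot v v) *: x + (2 * s) *: v).

(** With [w = v.v] and [x.v = 0] the numerator has square [4 s^2 w - (1 + s^2 w)^2 = - (1 - s^2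
    w)^2]. *)
Lemma conic_deSitter x (v : V) (s : R) : deSitter x -> \sum_a xlow x a * v 0 a = 0 ->
  1 - s ^+ 2 * mdot v v != 0 -> deSitter (conic x v s).
Proof.
move=> xS xv n0; rewrite /deSitter/=.
have E (r p q : R) : mdot (r *: (p *: x + q *: v)) (r *: (p *: x + q *: v)) =
    r ^+ 2 * (p ^+ 2 * mdot x x + q ^+ 2 * mdot v v +
      2 * p * q * \sum_a xlow x a * v 0 a).
  rewrite /mdot !mulr_sumr -!big_split/= mulr_sumr.
  by apply: eq_bigr => a _; rewrite !mxE /xlow; ring.
rewrite /conic E xv xS; field; exact: n0.
Qed.

(** [dT a g x] is the derivative of [g] in the tangent direction [v], row [a] of [theta] with the
    second index raised. The conic passes through [x] with velocity [2 v] and stays on the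
    hyperboloid for small [s], so [g] vanishes along it; being rational, it treats timelike,
    spacelike and null [v] alike. *)
Lemma dT_near_eq0 g a x : smooth g -> deSitter x ->
  (\forall y \near x, deSitter y -> g y = 0) -> dT a g x = 0.
Proof.
move=> gs xS g0.
pose v : V := \row_b (e b * theta x a b).
have xv : \sum_b xlow x b * v 0 b = 0.
  rewrite -[RHS](sum_x_theta a xS); apply: eq_bigr => b _; rewrite mxE /xlow.
  by transitivity (e b * e b * (x 0 b * theta x a b)); [ring|rewrite eta5_sqr mul1r].
pose w := mdot v v.
have c0 : conic x v 0 = x.
  by rewrite /conic expr0n/= !mul0r subr0 addr0 invr1 mulr0 scale0r addr0 !scale1r.
have dc b : is_derive (0 : R) (1 : R) (fun s => conic x v s 0 b) (2 * v 0 b).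
  have -> : (fun s => conic x v s 0 b) =
      (fun s => (1 - s ^+ 2 * w)^-1 * ((1 + s ^+ 2 * w) * x 0 b + 2 * s * v 0 b)).
    by apply/funext => s; rewrite !mxE.
  have n0 : 1 - 0 ^+ 2 * w != 0 by rewrite expr0n/= mul0r subr0 oner_neq0.
  have d1 : is_derive (0 : R) (1 : R) (fun s : R => 1 - s ^+ 2 * w) 0.
    by apply: is_derive_eq; rewrite /GRing.scale/=; ring.
  have d2 := @is_deriveV R _ 0 0 1 n0 d1.
  have d3 : is_derive (0 : R) (1 : R)
      (fun s : R => (1 + s ^+ 2 * w) * x 0 b + 2 * s * v 0 b) (2 * v 0 b).
    by apply: is_derive_eq; rewrite /GRing.scale/=; ring.
  apply: (is_derive_eq (is_deriveM d2 d3)).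
  rewrite /GRing.scale/= expr0n/= !mul0r subr0 invr1; ring.
have := @is_derive_curve R g (conic x v) _ 0 dc (smooth_diff _ gs).
have cc : {for 0, continuous (conic x v)}.
  apply: differentiable_continuous; apply/derivable1_diffP.
  by apply/derivable_mxP => i b; rewrite (ord1 i); have d := dc b; exact: ex_derive.
have g0c : \forall s \near (0 : R), deSitter (conic x v s) -> g (conic x v s) = 0.
  by move: cc; rewrite /prop_for /continuous_at c0 => /(_ _ g0).
have Z : \forall s \near (0 : R), cst 0 s = (g \o conic x v) s.
  have cw : (fun s : R => 1 - s ^+ 2 * w) s @[s --> (0 : R)] --> (1 : R).
    rewrite -[X in _ --> X](_ : 1 - 0 ^+ 2 * w = 1); last first.
      by rewrite expr0n/= mul0r subr0.
    apply: cvgB; first exact: cvg_cst.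
    apply: cvgM; last exact: cvg_cst.
    exact: exprn_continuous.
  have : \forall s \near (0 : R), 1 - s ^+ 2 * w != 0.
    by apply: (cvgr_neq0 _ cw); exact: oner_neq0.
  move/filterI/(_ g0c); apply: (@filterS _ (nbhs (0 : R))) => s [sn0 gs0] /=.
  by rewrite gs0//; exact: conic_deSitter.
move=> D; have := near_eq_is_derive Z (is_derive_cst 0 (0 : R) (1 : R)).
move=> /(@derive_val _ _ _ _ _ _ _).
rewrite (@derive_val _ _ _ _ _ _ _ D) c0.
under eq_bigr do rewrite -mulrA.
rewrite -mulr_sumr => /eqP; rewrite mulf_eq0 pnatr_eq0/= => /eqP H.
by rewrite -[RHS]H; apply: eq_bigr => b _; rewrite mxE; ring.
Qed.

Lemma dT_eq0 g a x : smooth g -> (forall y, deSitter y -> g y = 0) ->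
  deSitter x -> dT a g x = 0.
Proof. by move=> gs g0 xS; apply: dT_near_eq0 => //; exact: (@nearW _ (nbhs x) _ _ g0). Qed.

Lemma dTD a g h : smooth g -> smooth h ->
  dT a (fun y => g y + h y) = fun x => dT a g x + dT a h x.
Proof.
move=> gs hs; apply/funext => x; rewrite /dT -big_split/=.
by apply: eq_bigr => b _; rewrite partialD ?mulrDr//; exact: smooth_diff.
Qed.

Lemma dTM a g h : smooth g -> smooth h ->
  dT a (fun y => g y * h y) = fun x => g x * dT a h x + h x * dT a g x.
Proof.
move=> gs hs; apply/funext => x; rewrite /dT !mulr_sumr -big_split/=.
by apply: eq_bigr => b _; rewrite partialM; [ring|exact: smooth_diff..].
Qed.

Lemma dT_cst a (k : R) : dT a (fun=> k) = fun=> 0.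
Proof.
by apply/funext => x; rewrite /dT big1// => b _; rewrite partial_cst mulr0.
Qed.

Lemma dTZ a (k : R) g : smooth g ->
  dT a (fun y => k * g y) = fun x => k * dT a g x.
Proof.
move=> gs; rewrite dTM//; last exact: smooth_cst.
by rewrite dT_cst; apply/funext => x; rewrite mulr0 addr0.
Qed.

Lemma dTB a g h : smooth g -> smooth h ->
  dT a (fun y => g y - h y) = fun x => dT a g x - dT a h x.
Proof.
move=> gs hs; under eq_fun do rewrite -[h _]mul1r -mulNr.
rewrite dTD// ?dTZ//; last by apply: smoothM => //; exact: smooth_cst.
by apply/funext => x; rewrite mulN1r.
Qed.

Lemma dT_sum a (I : finType) (F : I -> V -> R) : (forall i, smooth (F i)) ->
  dT a (fun y => \sum_i F i y) = fun x => \sum_i dT a (F i) x.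
Proof.
move=> Fs; suff H (r : seq I) : smooth (fun y => \sum_(i <- r) F i y) /\
    dT a (fun y => \sum_(i <- r) F i y) = fun x => \sum_(i <- r) dT a (F i) x.
  exact: (H _).2.
elim: r => [|i r [IHs IH]].
  split; first by under eq_fun do rewrite big_nil; exact: smooth_cst.
  under eq_fun do rewrite big_nil.
  by rewrite dT_cst; apply/funext => x; rewrite big_nil.
split; first by under eq_fun do rewrite big_cons; exact: smoothD.
under eq_fun do rewrite big_cons.
by rewrite dTD// IH; apply/funext => x; rewrite big_cons.
Qed.

Lemma dT_coord a b : dT b (fun y => y 0 a) = fun x => e a * theta x b a.
Proof.
apply/funext => x; rewrite /dT (bigD1 a)//= big1 ?addr0.
  by rewrite partial_coord eqxx mulr1 mulrC.
by move=> c /negbTE ca; rewrite partial_coord ca mulr0.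
Qed.

Lemma dT_xlow a b : dT b (fun y => xlow y a) = fun x => theta x b a.
Proof.
rewrite (@dTZ b (e a) (fun y => y 0 a)); last exact: smooth_coord.
by rewrite dT_coord; apply/funext => x; rewrite mulrA eta5_sqr mul1r.
Qed.

Lemma dT_theta a b c : dT a (fun y => theta y b c) =
  fun x => theta x a b * xlow x c + xlow x b * theta x a c.
Proof.
rewrite /theta dTD; [|exact: smooth_cst|].
  rewrite dT_cst dTM; [|exact: smooth_xlow..].
  by rewrite !dT_xlow; apply/funext => x; rewrite /theta; ring.
by apply: smoothM; exact: smooth_xlow.
Qed.

(** In [dT a (dT b g)] the second-derivative term and the term in [theta x a b] are symmetric in the
    two indices; only [x_b dT_a g] survives antisymmetrization. *)
Lemma dT_comm a b g x : smooth g -> dT a (dT b g) x - dT b (dT a g) x =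
  xlow x b * dT a g x - xlow x a * dT b g x.
Proof.
move=> gs.
have E a' b' : dT a' (dT b' g) x =
    theta x a' b' * \sum_c e c * xlow x c * partial c g x
    + xlow x b' * dT a' g x
    + \sum_c \sum_d theta x b' c * theta x a' d * (e c * e d)
        * partial d (partial c g) x.
  rewrite [dT b' g](_ : _ = fun y => \sum_c theta y b' c * e c * partial c g y)//.
  rewrite dT_sum; last first.
    move=> c; apply: smoothM; last exact: smooth_partial.
    by apply: smoothM; [exact: smooth_theta|exact: smooth_cst].
  rewrite mulr_sumr mulr_sumr -!big_split/=; apply: eq_bigr => c _.
  have sc := smooth_partial c gs.
  rewrite dTM//; last first.
    by apply: smoothM; [exact: smooth_theta|exact: smooth_cst].
  rewrite dTM; [|exact: smooth_theta|exact: smooth_cst].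
  rewrite dT_cst dT_theta.
  have -> : theta x b' c * e c * dT a' (partial c g) x =
      \sum_d theta x b' c * theta x a' d * (e c * e d)
        * partial d (partial c g) x.
    by rewrite /dT mulr_sumr; apply: eq_bigr => d _; ring.
  ring.
rewrite (E a b) (E b a) (theta_sym x b a).
rewrite [X in _ - (_ + X)]exchange_big/=.
rewrite [X in _ - (_ + X)](_ : _ = \sum_c \sum_d theta x b c * theta x a d *
    (e c * e d) * partial d (partial c g) x); first by ring.
apply: eq_bigr => c _; apply: eq_bigr => d _.
by rewrite (partial_comm _ _ _ gs); ring.
Qed.

End transverse_calculus.

(** * A transverse vector field: radial contractions and field strength *)

Section transverse_fields.
Context {R : realType}.
Local Notation V := 'rV[R]_5.
Local Notation e := (eta5 R).
Variable T : 'I_5 -> V -> R.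
Hypothesis Ts : forall a, smooth (T a).
Hypothesis Tt : forall x, deSitter x -> \sum_a x 0 a * T a x = 0.
Implicit Types x : V.

Lemma sum_theta_transverse x a : deSitter x ->
  \sum_b e b * theta x a b * T b x = T a x.
Proof. by move=> xS; rewrite sum_theta Tt// mulr0 addr0. Qed.

(** The transverse derivative of the constraint [x.T = 0]: the derivative of [x] is [theta], which
    acts on [T] as the identity. *)
Lemma sum_x_dT_comp x b : deSitter x -> \sum_a x 0 a * dT b (T a) x = - T b x.
Proof.
move=> xS; apply/eqP; rewrite -addr_eq0; apply/eqP.
have := @dT_eq0 R (fun y => \sum_a y 0 a * T a y) b x
  (smooth_sum (fun a => smoothM (smooth_coord a) (Ts a))) Tt xS.
rewrite dT_sum; last by move=> a; apply: smoothM => //; exact: smooth_coord.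
under eq_bigr do rewrite (dTM _ (smooth_coord _) (Ts _)) dT_coord.
rewrite big_split/= => H; rewrite -[RHS]H; congr (_ + _).
rewrite -[LHS](sum_theta_transverse b xS).
by apply: eq_bigr => a _; ring.
Qed.

(** The first derivative of the constraint, [psi b], again vanishes on the hyperboloid, so it may be
    differentiated once more. In the contraction [dT^b psi_b = 0] the term in [theta] and the term
    [dT^b T_b] each give one divergence. *)
Lemma sum_x_Q0 x : deSitter x -> \sum_a x 0 a * Q0 (T a) x = 2 * divT T x.
Proof.
move=> xS.
pose psi b (y : V) := \sum_a y 0 a * dT b (T a) y + T b y.
have xdT_s b a : smooth (fun y : V => y 0 a * dT b (T a) y).
  by apply: smoothM; [exact: smooth_coord|exact: smooth_dT].
have psi_s b : smooth (psi b) by apply: smoothD => //; exact: smooth_sum.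
have psi0 b y : deSitter y -> psi b y = 0.
  by move=> yS; rewrite /psi sum_x_dT_comp// addNr.
have E b : dT b (psi b) x =
    \sum_a e a * theta x b a * dT b (T a) x
    + \sum_a x 0 a * dT b (dT b (T a)) x + dT b (T b) x.
  rewrite /psi dTD//; last exact: smooth_sum.
  rewrite dT_sum//= -[in RHS]big_split/=; congr (_ + _); apply: eq_bigr => a _.
  by rewrite dTM ?dT_coord; [ring|exact: smooth_coord|exact: smooth_dT].
have : \sum_b e b * dT b (psi b) x = 0.
  by rewrite big1// => b _; rewrite (@dT_eq0 _ (psi b)) ?mulr0//; exact: psi0.
under eq_bigr do rewrite E !mulrDr.
rewrite !big_split/=.
have -> : \sum_b e b * (\sum_a e a * theta x b a * dT b (T a) x) = divT T x.
  under eq_bigr do rewrite mulr_sumr.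
  rewrite exchange_big/=.
  transitivity (\sum_a e a * (\sum_b e b * theta x a b * dT b (T a) x)).
    apply: eq_bigr => a _; rewrite mulr_sumr; apply: eq_bigr => b _.
    by rewrite (theta_sym x b a); ring.
  by apply: eq_bigr => a _; rewrite sum_theta sum_x_dT// mulr0 addr0.
have -> : \sum_b e b * (\sum_a x 0 a * dT b (dT b (T a)) x) =
    - \sum_a x 0 a * Q0 (T a) x.
  under eq_bigr do rewrite mulr_sumr.
  rewrite exchange_big/= -sumrN; apply: eq_bigr => a _.
  rewrite /Q0 mulrN opprK mulr_sumr; apply: eq_bigr => b _; ring.
rewrite -/(divT T x) => H.
by apply/eqP; rewrite -subr_eq0 -oppr_eq0; apply/eqP; rewrite -[RHS]H; ring.
Qed.

Definition field_strength a b x := nablaT a T b x - nablaT b T a x.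

Local Notation F := field_strength.

Lemma smooth_nablaT a b : smooth (nablaT a T b).
Proof.
by apply: smoothB; [exact: smooth_dT|apply: smoothM => //; exact: smooth_xlow].
Qed.

Lemma smooth_field_strength a b : smooth (F a b).
Proof. by apply: smoothB; exact: smooth_nablaT. Qed.

Lemma field_strengthC a b x : F a b x = - F b a x.
Proof. by rewrite /field_strength; ring. Qed.

(** The correction term of [nablaT] is responsible: [x^a x_a T_b = - T_b] cancels
    [- x^a dT_b T_a = T_b]. *)
Lemma sum_x_field_strength x b : deSitter x -> \sum_a x 0 a * F a b x = 0.
Proof.
move=> xS.
transitivity (\sum_a x 0 a * dT a (T b) x - xlow x b * (\sum_a x 0 a * T a x)
    - \sum_a x 0 a * dT b (T a) x + (\sum_a x 0 a * xlow x a) * T b x).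
  rewrite mulr_sumr mulr_suml -!sumrB -big_split/=.
  by apply: eq_bigr => a _; rewrite /field_strength /nablaT; ring.
rewrite sum_x_dT// Tt// sum_x_dT_comp// sum_x_xlow//; ring.
Qed.

(** Convertible with [field_expr] at a fixed Lie-algebra index; later proofs pass between the two by
    conversion. *)
Definition EL_field b x :=
  - Q0 (T b) x + 2 * T b x - xlow x b * divT T x - dT b (divT T) x.

(** [- Q0] contributes [- 2 divT], the term [- x_b divT] contributes [+ divT] because [x.x = -1],
    and the other two terms are orthogonal to [x]. *)
Lemma sum_x_EL x : deSitter x -> \sum_b x 0 b * EL_field b x = - divT T x.
Proof.
move=> xS.
transitivity (- (\sum_b x 0 b * Q0 (T b) x) + 2 * (\sum_b x 0 b * T b x)
   - (\sum_b x 0 b * xlow x b) * divT T x - \sum_b x 0 b * dT b (divT T) x).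
  rewrite mulr_sumr mulr_suml -sumrN -big_split/= -!sumrB.
  by apply: eq_bigr => b _; rewrite /EL_field; ring.
rewrite sum_x_Q0// Tt// sum_x_xlow// sum_x_dT//; ring.
Qed.

(** Once the commutator has moved [dT b] outside, the undifferentiated terms are [- T_b] from
    [theta], [- T_b] from [x^a dT_b T_a] and [4 T_b] from the trace, hence the coefficient 2. The
    surplus [x_b divT] is radial. *)
Lemma div_field_strength x b : deSitter x ->
  \sum_a e a * dT a (F a b) x = EL_field b x - xlow x b * divT T x.
Proof.
move=> xS.
have E a : dT a (F a b) x = dT a (dT a (T b)) x
    - (theta x a b * T a x + xlow x b * dT a (T a) x)
    - (dT b (dT a (T a)) x + xlow x b * dT a (T a) x - xlow x a * dT b (T a) x)
    + (theta x a a * T b x + xlow x a * dT a (T b) x).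
  have C := dT_comm a b x (Ts a).
  rewrite /field_strength /nablaT.
  have s1 c d : smooth (fun y => xlow y c * T d y).
    by apply: smoothM => //; exact: smooth_xlow.
  have s2 c d : smooth (dT c (T d)) by exact: smooth_dT.
  rewrite dTB; [|exact: smoothB..].
  have M c d : dT a (fun y => xlow y c * T d y) =
      fun y => xlow y c * dT a (T d) y + T d y * theta y a c.
    by rewrite (dTM _ (smooth_xlow c) (Ts d)) dT_xlow.
  rewrite !dTB// !M.
  have -> : dT a (dT b (T a)) x = dT b (dT a (T a)) x +
      (xlow x b * dT a (T a) x - xlow x a * dT b (T a) x).
    by rewrite -C addrCA subrr addr0.
  clear C s1 s2 M.
  move: (dT a (dT a (T b)) x) (dT b (dT a (T a)) x) (dT a (T b) x)
    (dT b (T a) x) (dT a (T a) x) (T a x) (T b x) (theta x a b) (theta x a a)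
    (xlow x a) (xlow x b) => p1 p2 p3 p4 p5 p6 p7 p8 p9 p10 p11.
  ring.
transitivity (- Q0 (T b) x - \sum_a e a * theta x b a * T a x
    - 2 * xlow x b * divT T x - \sum_a e a * dT b (dT a (T a)) x
    + \sum_a x 0 a * dT b (T a) x + (\sum_a e a * theta x a a) * T b x
    + \sum_a x 0 a * dT a (T b) x).
  rewrite /Q0 opprK /divT mulr_sumr mulr_suml -!sumrB -!big_split/=.
  apply: eq_bigr => a _; rewrite E (theta_sym x b a).
  rewrite /xlow.
  move: (dT a (dT a (T b)) x) (dT b (dT a (T a)) x) (dT a (T b) x)
    (dT b (T a) x) (dT a (T a) x) (T a x) (T b x) (theta x a b) (theta x a a)
    => p1 p2 p3 p4 p5 p6 p7 p8 p9.
  (* [ring] does not know [eta5_sqr]; the two sides differ by exactly this multiple of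
     [e a * e a - 1]. *)
  have K0 : (e a * e a - 1) * (x 0 a * (p3 + p4)) = 0.
    by rewrite eta5_sqr subrr mul0r.
  apply: subr0_eq; rewrite -[RHS]K0; ring.

rewrite sum_theta_transverse// sum_x_dT_comp// sum_eta_theta// sum_x_dT//.
have D : dT b (divT T) x = \sum_a e a * dT b (dT a (T a)) x.
  rewrite [divT T](_ : _ = fun y => \sum_a e a * dT a (T a) y)// dT_sum.
    by apply: eq_bigr => a _; rewrite dTZ//; exact: smooth_dT.
  by move=> a; apply: smoothM; [exact: smooth_cst|exact: smooth_dT].
rewrite /EL_field D.
move: (Q0 _ _) (divT _ _) (\sum_a _ * dT b _ _) (xlow _ _) (T _ _) => *; ring.
Qed.

End transverse_fields.

(** * Pairing the field strengths of two transverse fields *)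

Section two_fields.
Context {R : realType}.
Local Notation V := 'rV[R]_5.
Local Notation e := (eta5 R).
Variables T k : 'I_5 -> V -> R.
Hypothesis Ts : forall a, smooth (T a).
Hypothesis Tt : forall x, deSitter x -> \sum_a x 0 a * T a x = 0.
Hypothesis ks : forall a, smooth (k a).
Hypothesis kt : forall x, deSitter x -> \sum_a x 0 a * k a x = 0.

(** The current of the integration by parts; it is tangent because the field strength is. *)
Definition flux a x := \sum_b e b * (field_strength T a b x * k b x).

Lemma sum_x_flux x : deSitter x -> \sum_a x 0 a * flux a x = 0.
Proof.
move=> xS; rewrite /flux; under eq_bigr do rewrite mulr_sumr.
rewrite exchange_big/= big1// => b _.
transitivity ((\sum_a x 0 a * field_strength T a b x) * (e b * k b x)).
  by rewrite mulr_suml; apply: eq_bigr => a _; ring.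
by rewrite sum_x_field_strength// mul0r.
Qed.

(** Antisymmetry of the first factor turns the second into [2 nablaT_a k_b], whose correction
    [x_b k_a] drops because the field strength is tangent; the rest is the Leibniz rule for
    [flux]. *)
Lemma field_strength_pairing x : deSitter x ->
  \sum_a \sum_b e a * e b * (field_strength T a b x * field_strength k a b x)
  = 2 * (\sum_a e a * dT a (flux a) x)
    - 2 * (\sum_b e b * (EL_field T b x * k b x)).
Proof.
move=> xS.
have E a : dT a (flux a) x = \sum_b e b * (field_strength T a b x * dT a (k b) x)
    + \sum_b e b * (k b x * dT a (field_strength T a b) x).
  have s1 b : smooth (fun y => field_strength T a b y * k b y).
    by apply: smoothM => //; exact: smooth_field_strength.
  rewrite /flux dT_sum; last first.
    by move=> b; apply: smoothM => //; exact: smooth_cst.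
  rewrite -big_split/=; apply: eq_bigr => b _.
  rewrite dTZ// dTM//; last exact: smooth_field_strength.
  by rewrite mulrDr.
have H1 : \sum_a e a * \sum_b e b * (k b x * dT a (field_strength T a b) x) =
    \sum_b e b * (EL_field T b x * k b x).
  transitivity (\sum_b e b * k b x * (\sum_a e a * dT a (field_strength T a b) x)).
    under eq_bigr do rewrite mulr_sumr.
    rewrite exchange_big/=; apply: eq_bigr => b _; rewrite mulr_sumr.
    by apply: eq_bigr => a _; ring.
  (* The surplus radial term of [div_field_strength] meets [x.k = 0]. *)
  transitivity (\sum_b e b * (EL_field T b x * k b x)
      - divT T x * \sum_b x 0 b * k b x).
    rewrite mulr_sumr -sumrB; apply: eq_bigr => b _.
    rewrite div_field_strength// /xlow.
    have -> : e b * k b x * (EL_field T b x - e b * x 0 b * divT T x) =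
        e b * k b x * EL_field T b x - e b * e b * (k b x * x 0 b * divT T x).
      by ring.
    by rewrite eta5_sqr; ring.
  by rewrite kt// mulr0 subr0.
under [X in 2 * X - _]eq_bigr do rewrite E mulrDr.
rewrite big_split/= H1 mulrDr addrK.
pose G a b := e a * e b * (field_strength T a b x * dT a (k b) x).
have H2 : \sum_a e a * \sum_b e b * (field_strength T a b x * dT a (k b) x) =
    \sum_a \sum_b G a b.
  by apply: eq_bigr => a _; rewrite mulr_sumr; apply: eq_bigr => b _; rewrite /G; ring.
have H3 : \sum_a \sum_b e a * e b * (field_strength T a b x * (xlow x b * k a x)) = 0.
  rewrite big1// => a _.
  transitivity (- (e a * k a x * \sum_b x 0 b * field_strength T b a x)).
    rewrite mulr_sumr -sumrN; apply: eq_bigr => b _.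
    rewrite (field_strengthC T a b) /xlow.
    transitivity (- (e b * e b * (e a * k a x * (x 0 b * field_strength T b a x)))).
      ring.
    by rewrite eta5_sqr mul1r.
  by rewrite sum_x_field_strength// mulr0 oppr0.
have H4 : \sum_a \sum_b e a * e b * (field_strength T a b x * nablaT a k b x) =
    \sum_a \sum_b G a b.
  rewrite -[RHS]subr0 -[X in _ = _ - X]H3 -sumrB; apply: eq_bigr => a _.
  by rewrite -sumrB; apply: eq_bigr => b _; rewrite /G /nablaT; ring.
rewrite H2 mulr2n mulrDl mul1r -{1}H4 -{1}H4 [X in _ = _ + X]exchange_big/=.
rewrite -big_split/=; apply: eq_bigr => a _.
rewrite -big_split/=; apply: eq_bigr => b _.
rewrite (field_strengthC T b a) /field_strength; ring.
Qed.

End two_fields.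

(** * Iterated integrals *)

Section iterated_integral.
Context {R : realType}.
Implicit Types (H A B : R -> R -> R -> R -> R).
Local Notation pi := (@pi R).

(** Joint rather than separate continuity makes every partial integral continuous in the remaining
    coordinates. *)
Definition cont4 H := continuous (fun z : R * R * R * R => H z.1.1.1 z.1.1.2 z.1.2 z.2).

Definition int_phi H t chi th := itvI 0 (2 * pi) (H t chi th).
Definition int_th H t chi := itvI 0 pi (int_phi H t chi).
Definition int_chi H t := itvI 0 pi (int_th H t).
Definition int_all H : R := \int[@lebesgue_measure R]_(t in [set: R]) int_chi H t.

(** Only [t] has an unbounded range, so this is all that compact support has to provide. *)
Definition t_support H := exists T : R, forall t, T < `|t| ->
  forall chi th phi, H t chi th phi = 0.

Lemma pi2_ge0 : 0 <= 2 * pi. Proof. by rewrite mulr_ge0// pi_ge0. Qed.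

Lemma cont_phi H : cont4 H ->
  continuous (fun z : R * R * R => int_phi H z.1.1 z.1.2 z.2).
Proof.
move=> cH; apply: (@itvI_continuous _ _ _ _
  (fun z : R * R * R => H z.1.1 z.1.2 z.2)) => //; exact: pi2_ge0.
Qed.

Lemma cont_th H : cont4 H -> continuous (fun z : R * R => int_th H z.1 z.2).
Proof.
move=> cH; apply: (@itvI_continuous _ _ _ _
  (fun z : R * R => int_phi H z.1 z.2)); first exact: pi_ge0.
exact: cont_phi.
Qed.

Lemma cont_chi H : cont4 H -> continuous (int_chi H).
Proof.
move=> cH; apply: (@itvI_continuous _ _ _ _ (int_th H)); first exact: pi_ge0.
exact: cont_th.
Qed.

Lemma cont4_slice H t chi th : cont4 H -> continuous (H t chi th).
Proof.
by move=> cH; have := @continuous_slice _ _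
  (fun z : R * R * R => H z.1.1 z.1.2 z.2) (t, chi, th) cH.
Qed.

Lemma cont_phi_slice H t chi : cont4 H -> continuous (int_phi H t chi).
Proof.
by move=> cH; have := @continuous_slice _ _
  (fun z : R * R => int_phi H z.1 z.2) (t, chi) (cont_phi cH).
Qed.

Lemma cont_th_slice H t : cont4 H -> continuous (int_th H t).
Proof.
by move=> cH; have := @continuous_slice _ _ (int_th H) t (cont_th cH).
Qed.

Lemma int_chi_support H : t_support H -> exists T : R, forall t, T < `|t| ->
  int_chi H t = 0.
Proof.
move=> [T HT]; exists T => t tT; rewrite /int_chi (@eq_itvI _ _ _ _ (fun=> 0)) ?itvI0//.
move=> chi _; rewrite /int_th (@eq_itvI _ _ _ _ (fun=> 0)) ?itvI0// => th _.
by rewrite /int_phi (@eq_itvI _ _ _ _ (fun=> 0)) ?itvI0// => phi _; exact: HT.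
Qed.

(** Every larger [T'] is allowed so that several integrands can be brought to one common range. *)
Lemma int_allE H : t_support H ->
  exists T : R, forall T', T <= T' -> int_all H = itvI (- T') T' (int_chi H).
Proof.
move=> /int_chi_support[T HT]; exists T => T' TT'.
apply: integral_compact_support => t tT; apply: HT; exact: le_lt_trans tT.
Qed.

Lemma int_all_eq A B : (forall t chi th phi, A t chi th phi = B t chi th phi) ->
  int_all A = int_all B.
Proof.
move=> AB; congr int_all; apply/funext => t; apply/funext => chi.
by apply/funext => th; apply/funext => phi.
Qed.

Lemma int_allD A B : cont4 A -> cont4 B -> t_support A -> t_support B ->
  int_all (fun t chi th phi => A t chi th phi + B t chi th phi)
  = int_all A + int_all B.
Proof.
move=> cA cB sA sB.
have [TA HA] := int_allE sA; have [TB HB] := int_allE sB.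
have E t : int_chi (fun t chi th phi => A t chi th phi + B t chi th phi) t =
    int_chi A t + int_chi B t.
  rewrite /int_chi -itvID//; try exact: cont_th_slice.
  apply: eq_itvI => chi _; rewrite /int_th -itvID//; try exact: cont_phi_slice.
  by apply: eq_itvI => th _; rewrite /int_phi itvID//; exact: cont4_slice.
have sAB : t_support (fun t chi th phi => A t chi th phi + B t chi th phi).
  case: sA sB => [T1 H1] [T2 H2]; exists (Num.max T1 T2) => t.
  by rewrite gt_max => /andP[h1 h2] *; rewrite H1// H2// addr0.
have [TC HC] := int_allE sAB.
pose T := Num.max TA (Num.max TB TC).
have lA : TA <= T by rewrite le_max lexx.
have lB : TB <= T by rewrite !le_max lexx orbT.
have lC : TC <= T by rewrite !le_max lexx !orbT.
rewrite (HA _ lA) (HB _ lB) (HC _ lC) -itvID; try exact: cont_chi.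
by apply: eq_itvI => t _; rewrite E.
Qed.

Lemma int_allZ A (k : R) : cont4 A -> t_support A ->
  int_all (fun t chi th phi => k * A t chi th phi) = k * int_all A.
Proof.
move=> cA sA.
have [TA HA] := int_allE sA.
have E t : int_chi (fun t chi th phi => k * A t chi th phi) t = k * int_chi A t.
  rewrite /int_chi -itvIZ//; try exact: cont_th_slice.
  apply: eq_itvI => chi _; rewrite /int_th -itvIZ//; try exact: cont_phi_slice.
  by apply: eq_itvI => th _; rewrite /int_phi itvIZ//; exact: cont4_slice.
have sk : t_support (fun t chi th phi => k * A t chi th phi).
  by case: sA => [T1 H1]; exists T1 => t h1 *; rewrite H1// mulr0.
have [TC HC] := int_allE sk.
pose T := Num.max TA TC.
have lA : TA <= T by rewrite le_max lexx.
have lC : TC <= T by rewrite !le_max lexx orbT.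
rewrite (HA _ lA) (HC _ lC) -itvIZ; last exact: cont_chi.
by apply: eq_itvI => t _; rewrite E.
Qed.

Lemma int_chi0 t : int_chi (fun _ _ _ _ => 0) t = 0.
Proof.
rewrite /int_chi (@eq_itvI _ _ _ _ (fun=> 0)) ?itvI0// => chi _.
rewrite /int_th (@eq_itvI _ _ _ _ (fun=> 0)) ?itvI0// => th _.
by rewrite /int_phi itvI0.
Qed.

Lemma int_all0 : int_all (fun _ _ _ _ => 0) = 0.
Proof.
have /int_allE[T HT] : t_support (fun _ _ _ _ => 0 : R) by exists 0.
rewrite (HT _ (lexx _)) (@eq_itvI _ _ _ _ (fun=> 0)) ?itvI0// => t _.
exact: int_chi0.
Qed.

(** Vanishing is pushed from the outermost integral inwards, each partial integral being continuous
    and nonnegative in its variable. *)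
Lemma int_all_eq0 H : cont4 H -> t_support H ->
  (forall t chi th phi, 0 <= chi <= pi -> 0 <= th <= pi -> 0 <= H t chi th phi) ->
  int_all H = 0 ->
  forall t chi th phi, 0 <= chi <= pi -> 0 <= th <= pi -> 0 <= phi <= 2 * pi ->
  H t chi th phi = 0.
Proof.
move=> cH sH H0 I0 t chi th phi hchi hth hphi.
have [T HT] := int_allE sH.
have p0 := @pi_gt0 R.
have phi0 t' chi' th' : 0 <= chi' <= pi -> 0 <= th' <= pi ->
    0 <= int_phi H t' chi' th'.
  by move=> *; apply: itvI_ge0 => ? _; exact: H0.
have th0 t' chi' : 0 <= chi' <= pi -> 0 <= int_th H t' chi'.
  by move=> *; apply: itvI_ge0 => ? ?; exact: phi0.
have chi0 t' : 0 <= int_chi H t' by apply: itvI_ge0 => ? ?; exact: th0.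
(* The range is enlarged until it contains the given [t]. *)
pose T' := Num.max T (`|t| + 1).
have TT' : T <= T' by rewrite le_max lexx.
have tT' : `|t| + 1 <= T' by rewrite le_max lexx orbT.
have z3 : int_chi H t = 0.
  apply: (@itvI_eq0 _ (- T') T').
  - have := normr_ge0 t; lra.
  - exact: cont_chi.
  - by move=> x _; exact: chi0.
  - by rewrite -HT.
  - by rewrite -ler_norml; lra.
have z2 : int_th H t chi = 0.
  apply: (itvI_eq0 p0 _ _ z3 hchi); first exact: cont_th_slice.
  by move=> x; exact: th0.
have z1 : int_phi H t chi th = 0.
  apply: (itvI_eq0 p0 _ _ z2 hth); first exact: cont_phi_slice.
  by move=> x; exact: phi0.
have p20 : 0 < 2 * pi by rewrite mulr_gt0.
apply: (itvI_eq0 p20 _ _ z1 hphi); first exact: cont4_slice.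
by move=> x _; exact: H0.
Qed.

Lemma int_all_dphi A B : cont4 B ->
  (forall t chi th phi, is_derive phi (1 : R) (A t chi th) (B t chi th phi)) ->
  (forall t chi th, A t chi th 0 = A t chi th (2 * pi)) -> int_all B = 0.
Proof.
move=> cB dA per; rewrite -int_all0; apply: eq_Rintegral => t _.
apply: eq_itvI => chi _; apply: eq_itvI => th _; rewrite /int_phi itvI0.
rewrite (itvI_FTC _ (dA t chi th)) ?per ?subrr//; last exact: cont4_slice.
by rewrite mulr_gt0// pi_gt0.
Qed.

(** Differentiating the inner [phi] integral under the integral sign makes the fundamental theorem
    applicable in [th]. *)
Lemma int_all_dth A B : cont4 A -> cont4 B ->
  (forall t chi th phi, is_derive th (1 : R) (fun th => A t chi th phi) (B t chi th phi)) ->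
  (forall t chi phi, A t chi 0 phi = 0) ->
  (forall t chi phi, A t chi pi phi = 0) -> int_all B = 0.
Proof.
move=> cA cB dA A0 Api; rewrite -int_all0; apply: eq_Rintegral => t _.
apply: eq_itvI => chi _; rewrite /int_th.
have d th : is_derive th (1 : R) (int_phi A t chi) (int_phi B t chi th).
  apply: (@is_derive_itvI _ _ _ (A t chi) (B t chi)).
  - exact: pi2_ge0.
  - by move=> s; exact: cont4_slice.
  - move=> z; apply: (@continuous_comp _ _ _ (fun z : R * R => (t, chi, z.1, z.2)) _ _ _ (cB _)).
    exact: (cvg_pair (cvg_pair (cvg_cst (t, chi)) cvg_fst) cvg_snd).
rewrite (itvI_FTC (@pi_gt0 R) d); last exact: cont_phi_slice.
rewrite /int_phi (@eq_itvI _ _ _ _ (fun=> 0)) ?itvI0//.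
by rewrite (@eq_itvI _ _ _ _ (fun=> 0)) ?itvI0 ?subrr.
Qed.

Lemma int_all_dchi A B : cont4 A -> cont4 B ->
  (forall t chi th phi, is_derive chi (1 : R) (fun chi => A t chi th phi) (B t chi th phi)) ->
  (forall t th phi, A t 0 th phi = 0) ->
  (forall t th phi, A t pi th phi = 0) -> int_all B = 0.
Proof.
move=> cA cB dA A0 Api; rewrite -int_all0; apply: eq_Rintegral => t _.
rewrite [RHS]int_chi0 /int_chi.
have d1 th chi : is_derive chi (1 : R) (fun chi => int_phi A t chi th) (int_phi B t chi th).
  apply: (@is_derive_itvI _ _ _ (fun chi => A t chi th) (fun chi => B t chi th)).
  - exact: pi2_ge0.
  - by move=> s; exact: cont4_slice.
  - move=> z; apply: (@continuous_comp _ _ _ (fun z : R * R => (t, z.1, th, z.2)) _ _ _ (cB _)).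
    exact: (cvg_pair (cvg_pair (cvg_pair (cvg_cst t) cvg_fst) (cvg_cst th)) cvg_snd).
have d chi : is_derive chi (1 : R) (int_th A t) (int_th B t chi).
  apply: (@is_derive_itvI _ _ _ (int_phi A t) (int_phi B t) _ (@pi_ge0 R)
    (fun s => cont_phi_slice cA) (fun s y => d1 y s)) => z.
  apply: (@continuous_comp _ _ _ (fun z : R * R => (t : R, z.1, z.2)) (fun z : R * R * R => int_phi B z.1.1 z.1.2 z.2) z _ (@cont_phi B cB _)).
    exact: (cvg_pair (cvg_pair (cvg_cst t) cvg_fst) cvg_snd).
rewrite (itvI_FTC (@pi_gt0 R) d); last exact: cont_th_slice.
rewrite /int_th (@eq_itvI _ _ _ _ (fun=> 0)) ?itvI0//; last first.
  by move=> th _; rewrite /int_phi (@eq_itvI _ _ _ _ (fun=> 0)) ?itvI0.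
rewrite (@eq_itvI _ _ _ _ (fun=> 0)) ?itvI0 ?subrr//.
by move=> th _; rewrite /int_phi (@eq_itvI _ _ _ _ (fun=> 0)) ?itvI0.
Qed.

Lemma int_all_dt A B : cont4 A -> cont4 B -> t_support A -> t_support B ->
  (forall t chi th phi, is_derive t (1 : R) (fun t => A t chi th phi) (B t chi th phi)) ->
  int_all B = 0.
Proof.
move=> cA cB sA sB dA.
have d1 th chi t : is_derive t (1 : R) (fun t => int_phi A t chi th) (int_phi B t chi th).
  apply: (@is_derive_itvI _ _ _ (fun t => A t chi th) (fun t => B t chi th)).
  - exact: pi2_ge0.
  - by move=> s; exact: cont4_slice.
  - move=> z; apply: (@continuous_comp _ _ _ (fun z : R * R => (z.1, chi, th, z.2)) _ _ _ (cB _)).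
    exact: (cvg_pair (cvg_pair (cvg_pair cvg_fst (cvg_cst chi)) (cvg_cst th)) cvg_snd).
have d2 chi t : is_derive t (1 : R) (fun t => int_th A t chi) (int_th B t chi).
  apply: (@is_derive_itvI _ _ _ (fun t => int_phi A t chi)
    (fun t => int_phi B t chi) _ (@pi_ge0 R)
    (fun s => cont_phi_slice cA) (fun s y => d1 y chi s)) => z.
  apply: (@continuous_comp _ _ _ (fun z : R * R => (z.1, chi, z.2)) (fun z : R * R * R => int_phi B z.1.1 z.1.2 z.2) z _ (@cont_phi B cB _)).
    exact: (cvg_pair (cvg_pair cvg_fst (cvg_cst chi)) cvg_snd).
have d t : is_derive t (1 : R) (int_chi A) (int_chi B t).
  exact: (@is_derive_itvI _ 0 pi (int_th A) (int_th B) t (@pi_ge0 R)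
    (fun s => @cont_th_slice A s cA) (fun s y => d2 y s) (cont_th cB)).
have [T HT] := int_allE sB; have [T2 HT2] := int_chi_support sA.
(* The [+ 1] puts both ends strictly beyond the support of [A] and keeps the range nondegenerate. *)
pose T' := Num.max T (`|T2| + 1).
have l1 : T <= T' by rewrite le_max lexx.
have l2 : `|T2| + 1 <= T' by rewrite le_max lexx orbT.
have T2n := ler_norm T2; have T20 := normr_ge0 T2.
have TT' : - T' < T' by lra.
rewrite (HT _ l1) (itvI_FTC TT' d (cont_chi cB)).
by rewrite !HT2 ?subrr// ?normrN ger0_norm//; lra.
Qed.

End iterated_integral.

(** * Global coordinates *)

Section global_coordinates.
Context {R : realType}.
Local Notation V := 'rV[R]_5.
Local Notation pi := (@pi R).
Implicit Types (t chi th phi : R) (a : 'I_5).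

Global Instance is_derive_sinh t : is_derive t (1 : R) (@sinh R) (cosh t).
Proof.
have dN : is_derive t (1 : R) (fun s : R => expR (- s)) (- expR (- t)).
  by apply: (is_derive_eq (@is_derive1_comp _ (@expR R) (fun s : R => - s) t _ _ _ _)); rewrite mulrN1.
have d : is_derive t (1 : R) (fun s : R => 2^-1 * (expR s - expR (- s))) (cosh t).
  by apply: is_derive_eq; rewrite /GRing.scale/= /cosh; ring.
rewrite (_ : @sinh R = fun s : R => 2^-1 * (expR s - expR (- s)))//.
by apply/funext => s; rewrite /sinh mulrC.
Qed.

Global Instance is_derive_cosh t : is_derive t (1 : R) (@cosh R) (sinh t).
Proof.
have dN : is_derive t (1 : R) (fun s : R => expR (- s)) (- expR (- t)).
  by apply: (is_derive_eq (@is_derive1_comp _ (@expR R) (fun s : R => - s) t _ _ _ _)); rewrite mulrN1.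
have d : is_derive t (1 : R) (fun s : R => 2^-1 * (expR s + expR (- s))) (sinh t).
  by apply: is_derive_eq; rewrite /GRing.scale/= /sinh; ring.
rewrite (_ : @cosh R = fun s : R => 2^-1 * (expR s + expR (- s)))//.
by apply/funext => s; rewrite /cosh mulrC.
Qed.

Lemma cosh2_sinh2 t : cosh t ^+ 2 = 1 + sinh t ^+ 2.
Proof.
have H : expR t * expR (- t) = 1 by rewrite -expRD subrr expR0.
apply: subr0_eq; transitivity (expR t * expR (- t) - 1).
  by rewrite /cosh /sinh; field.
by rewrite H subrr.
Qed.

Lemma cosh_gt0 t : 0 < cosh t.
Proof. by rewrite divr_gt0// addr_gt0// expR_gt0. Qed.

(** [sinh t] is a coordinate of the point, so this bounds [t] in terms of the norm of the point. *)
Lemma norm_sinh_ge t : `|t| / 2 <= `|sinh t|.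
Proof.
have H (s : R) : 0 <= s -> s / 2 <= sinh s.
  move=> s0; rewrite /sinh ler_pM2r//.
  have := expR_ge1Dx s; have : expR (- s) <= 1 by rewrite -expR0 ler_expR oppr_le0.
  lra.
have [t0|t0] := leP 0 t.
  by rewrite (ger0_norm t0) (le_trans (H _ t0))// ler_norm.
have -> : `|sinh t| = `|sinh (- t)|.
  by rewrite -normrN; congr `|_|; rewrite /sinh opprK; by field.
have t0' : 0 <= - t by rewrite oppr_ge0 ltW.
by rewrite (ltr0_norm t0) (le_trans (H _ t0'))// ler_norm.
Qed.

(* [p = sinh t * u + cosh t * y], [y = sin chi * n + cos chi * k4],
   [n = sin th * m + cos th * k3] decomposes [dS_point] into nested unit
   vectors; [u], [k3], [k4] are basis vectors and [em], [en], [ey] are the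
   angular derivatives of [m], [n], [y]. *)
Definition vk (k : nat) a : R := (a == k :> nat)%:R.
Definition vm phi a : R := cos phi * vk 1 a + sin phi * vk 2 a.
Definition em phi a : R := cos phi * vk 2 a - sin phi * vk 1 a.
Definition vn th phi a : R := sin th * vm phi a + cos th * vk 3 a.
Definition en th phi a : R := cos th * vm phi a - sin th * vk 3 a.
Definition vy chi th phi a : R := sin chi * vn th phi a + cos chi * vk 4 a.
Definition ey chi th phi a : R := cos chi * vn th phi a - sin chi * vk 4 a.
Definition vp t chi th phi a : R := sinh t * vk 0 a + cosh t * vy chi th phi a.
Definition ep t chi th phi a : R := cosh t * vk 0 a + sinh t * vy chi th phi a.

Lemma dS_pointE t chi th phi a : dS_point t chi th phi 0 a = vp t chi th phi a.
Proof.
rewrite mxE /vp /vy /vn /vm /vk.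
by case: a => [[|[|[|[|[|//]]]]] ?]/=; ring.
Qed.

(** Completeness of the orthonormal tangent frame [ep], [ey], [en], [em] of signature [(+,-,-,-)]:
    the left side is [theta] with both indices raised. [E1], [E2], [E3] express invariance of a
    quadratic form under a plane rotation, [E4] under a boost. *)
Lemma frame_complete t chi th phi a b :
  (if a == b then eta5 R a else 0) + vp t chi th phi a * vp t chi th phi b =
  ep t chi th phi a * ep t chi th phi b - ey chi th phi a * ey chi th phi b
  - en th phi a * en th phi b - em phi a * em phi b.
Proof.
have E0 : (if a == b then eta5 R a else 0) = vk 0 a * vk 0 b - vk 1 a * vk 1 b
    - vk 2 a * vk 2 b - vk 3 a * vk 3 b - vk 4 a * vk 4 b.
  rewrite /vk /eta5; case: a => [[|[|[|[|[|//]]]]] ?];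
    case: b => [[|[|[|[|[|//]]]]] ?]; rewrite /eq_op/=; ring.
have E1 : vm phi a * vm phi b + em phi a * em phi b =
    vk 1 a * vk 1 b + vk 2 a * vk 2 b.
  transitivity ((cos phi ^+ 2 + sin phi ^+ 2) * (vk 1 a * vk 1 b + vk 2 a * vk 2 b)).
    by rewrite /vm /em; ring.
  by rewrite cos2Dsin2 mul1r.
have E2 : vn th phi a * vn th phi b + en th phi a * en th phi b =
    vm phi a * vm phi b + vk 3 a * vk 3 b.
  transitivity ((cos th ^+ 2 + sin th ^+ 2) * (vm phi a * vm phi b + vk 3 a * vk 3 b)).
    by rewrite /vn /en; ring.
  by rewrite cos2Dsin2 mul1r.
have E3 : vy chi th phi a * vy chi th phi b + ey chi th phi a * ey chi th phi b =
    vn th phi a * vn th phi b + vk 4 a * vk 4 b.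
  transitivity ((cos chi ^+ 2 + sin chi ^+ 2) *
      (vn th phi a * vn th phi b + vk 4 a * vk 4 b)).
    by rewrite /vy /ey; ring.
  by rewrite cos2Dsin2 mul1r.
have E4 : vp t chi th phi a * vp t chi th phi b + vk 0 a * vk 0 b =
    ep t chi th phi a * ep t chi th phi b + vy chi th phi a * vy chi th phi b.
  apply: subr0_eq; transitivity ((cosh t ^+ 2 - (1 + sinh t ^+ 2)) *
      (vy chi th phi a * vy chi th phi b - vk 0 a * vk 0 b)).
    by rewrite /vp /ep; ring.
  by rewrite cosh2_sinh2 subrr mul0r.
move: E0 E1 E2 E3 E4 => -> ; lra.
Qed.

Lemma dS_point_deSitter t chi th phi : deSitter (dS_point t chi th phi).
Proof.
rewrite /deSitter/= /mdot !big_ord_recl big_ord0 !mxE/=.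
rewrite /eta5/= /bump/=.
have := cosh2_sinh2 t; have := cos2Dsin2 chi; have := cos2Dsin2 th.
have := cos2Dsin2 phi.
move: (cosh t) (sinh t) (cos chi) (sin chi) (cos th) (sin th) (cos phi) (sin phi).
move=> C S c1 s1 c2 s2 c3 s3 h3 h2 h1 hC.
transitivity (S ^+ 2 - C ^+ 2 * (c1 ^+ 2 + s1 ^+ 2 *
   (c2 ^+ 2 + s2 ^+ 2 * (c3 ^+ 2 + s3 ^+ 2)))); first by ring.
by rewrite h3 mulr1 h2 mulr1 h1 hC; ring.
Qed.

Lemma polar_upper (rho u v : R) : 0 <= rho -> 0 <= v ->
  u ^+ 2 + v ^+ 2 = rho ^+ 2 ->
  exists th, [/\ 0 <= th <= pi, u = rho * cos th & v = rho * sin th].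
Proof.
move=> r0 v0 H; have [rE|rn0] := eqVneq rho 0.
  have hu : u ^+ 2 = 0.
    by apply/eqP; rewrite eq_le sqr_ge0 andbT; have := sqr_ge0 v; rewrite rE in H; lra.
  have hv : v ^+ 2 = 0 by rewrite rE in H; lra.
  exists 0; rewrite lexx pi_ge0 rE !mul0r.
  move/eqP : hu; move/eqP : hv; rewrite !sqrf_eq0 => /eqP -> /eqP ->.
  by split.
have rp : 0 < rho by rewrite lt_neqAle eq_sym rn0.
have r20 : rho ^+ 2 != 0 by rewrite sqrf_eq0.
have H1 : 1 - (u / rho) ^+ 2 = (v / rho) ^+ 2.
  by rewrite !expr_div_n -[X in X - _](divff r20) -mulrBl -H; congr (_ / _); ring.
have ur : -1 <= u / rho <= 1.
  rewrite -ler_norml -(@ler_pXn2r _ 2)//= ?nnegrE// expr1n real_normK ?num_real//.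
  by have := sqr_ge0 (v / rho); lra.
exists (acos (u / rho)); rewrite acos_ge0// acos_lepi// acosK//.
rewrite sin_acos// H1 sqrtr_sqr ger0_norm ?divr_ge0//.
by split => //; rewrite mulrCA divff// mulr1.
Qed.

Lemma polar (rho u v : R) : 0 <= rho -> u ^+ 2 + v ^+ 2 = rho ^+ 2 ->
  exists phi, [/\ 0 <= phi <= 2 * pi, u = rho * cos phi & v = rho * sin phi].
Proof.
move=> r0 H; have p0 := @pi_ge0 R.
have [v0|v0] := leP 0 v.
  have [phi [/andP[h1 h2] hu hv]] := polar_upper r0 v0 H.
  by exists phi; split => //; rewrite h1/=; lra.
have nv0 : 0 <= - v by rewrite oppr_ge0 ltW.
have H' : u ^+ 2 + (- v) ^+ 2 = rho ^+ 2 by rewrite sqrrN.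
have [phi [/andP[h1 h2] hu hv]] := polar_upper r0 nv0 H'.
(* The angle of the reflected point [(u, - v)], negated and moved back into the range. *)
exists (- phi + pi *+ 2); rewrite cosD2pi sinD2pi cosN sinN.
split => //; last by rewrite mulrN -hv opprK.
by rewrite -mulr_natl; apply/andP; split; lra.
Qed.

(** The inverse hyperbolic sine: [s + c] and [c - s] are inverse to each other, so [ln (s + c)] has
    the required [sinh] and [cosh]. *)
Lemma sinh_surj (s : R) : exists2 t, sinh t = s & cosh t = Num.sqrt (1 + s ^+ 2).
Proof.
set c := Num.sqrt _.
have s20 := sqr_ge0 s.
have c2 : c ^+ 2 = 1 + s ^+ 2 by rewrite sqr_sqrtr//; lra.
have cs : `|s| < c.
  rewrite -(@ltr_pXn2r _ 2)//= ?nnegrE// ?sqrtr_ge0//.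
  by rewrite c2 real_normK ?num_real// ltrDr.
have e0 : 0 < s + c by move: cs; rewrite ltr_norml => /andP[]; lra.
have eV : (s + c)^-1 = c - s.
  apply: (mulfI (lt0r_neq0 e0)); rewrite divff ?gt_eqF//.
  by transitivity (c ^+ 2 - s ^+ 2); [rewrite c2; ring|ring].
exists (ln (s + c)); rewrite /sinh /cosh expRN lnK ?posrE// eV; by field.
Qed.

(** Successive polar decompositions: [x0] fixes [t], then [x4], [x3] and the pair [x1], [x2] fix the
    angles. The closed ranges also reach the poles, where the coordinates degenerate. *)
Lemma dS_point_surj x : deSitter x -> exists t chi th phi,
  [/\ 0 <= chi <= pi, 0 <= th <= pi, 0 <= phi <= 2 * pi &
      x = dS_point t chi th phi].
Proof.
rewrite /deSitter/= /mdot !big_ord_recl big_ord0 /eta5/= addr0 !mul1r.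
set x0 := x 0 ord0; set x1 := x 0 _; set x2 := x 0 (lift _ (lift _ _)).
set x3 := x 0 (lift _ (lift _ (lift _ _))); set x4 := x 0 _ => H.
pose r3 := Num.sqrt (x1 ^+ 2 + x2 ^+ 2 + x3 ^+ 2).
pose r2 := Num.sqrt (x1 ^+ 2 + x2 ^+ 2).
have q1 := sqr_ge0 x1; have q2 := sqr_ge0 x2; have q3 := sqr_ge0 x3.
have r32 : r3 ^+ 2 = x1 ^+ 2 + x2 ^+ 2 + x3 ^+ 2 by rewrite sqr_sqrtr//; lra.
have r22 : r2 ^+ 2 = x1 ^+ 2 + x2 ^+ 2 by rewrite sqr_sqrtr//; lra.
have [t tS tC] := sinh_surj x0.
have [||chi [hchi e4 e3]] := @polar_upper (cosh t) x4 r3 (ltW (cosh_gt0 t)).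
- exact: sqrtr_ge0.
- by rewrite cosh2_sinh2 tS r32; lra.
have [|||th [hth e3' e2]] := @polar_upper r3 x3 r2.
- exact: sqrtr_ge0.
- exact: sqrtr_ge0.
- by rewrite r32 r22; lra.
have [||phi [hphi e1 e2']] := @polar r2 x1 x2.
- exact: sqrtr_ge0.
- by rewrite r22.
exists t, chi, th, phi; split => //.
apply/rowP => a; rewrite mxE.
case: a => [[|[|[|[|[|//]]]]] ia]/=.
- by rewrite tS; congr (x _ _); apply/val_inj.
- rewrite mulrA -e3 mulrA -e2 -e1.
  by congr (x _ _); apply/val_inj.
- rewrite mulrA -e3 mulrA -e2 -e2'.
  by congr (x _ _); apply/val_inj.
- rewrite mulrA -e3 -e3'.
  by congr (x _ _); apply/val_inj.
- rewrite -e4.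
  by congr (x _ _); apply/val_inj.
Qed.

End global_coordinates.

(** * The invariant integral on test functions *)

Section dS_integration.
Context {R : realType}.
Local Notation V := 'rV[R]_5.
Local Notation e := (eta5 R).
Local Notation pi := (@pi R).
Implicit Types (t chi th phi : R) (a : 'I_5) (F g : V -> R).
Implicit Types (A B : R -> R -> R -> R -> R).

Lemma cont4_cst (k : R) : cont4 (fun _ _ _ _ => k).
Proof. by move=> z; exact: cvg_cst. Qed.

Lemma cont4D A B : cont4 A -> cont4 B ->
  cont4 (fun t chi th phi => A t chi th phi + B t chi th phi).
Proof. by move=> cA cB z; apply: cvgD; [exact: cA|exact: cB]. Qed.

Lemma cont4B A B : cont4 A -> cont4 B ->
  cont4 (fun t chi th phi => A t chi th phi - B t chi th phi).
Proof. by move=> cA cB z; apply: cvgB; [exact: cA|exact: cB]. Qed.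

Lemma cont4N A : cont4 A -> cont4 (fun t chi th phi => - A t chi th phi).
Proof. by move=> cA z; apply: cvgN; exact: cA. Qed.

Lemma cont4M A B : cont4 A -> cont4 B ->
  cont4 (fun t chi th phi => A t chi th phi * B t chi th phi).
Proof. by move=> cA cB z; apply: cvgM; [exact: cA|exact: cB]. Qed.

Lemma cont4X A n : cont4 A -> cont4 (fun t chi th phi => A t chi th phi ^+ n).
Proof.
move=> cA z; apply: (@continuous_comp _ _ _ _ (fun u : R => u ^+ n) _ (cA z)).
exact: exprn_continuous.
Qed.

Lemma cont4_sum (I : finType) (G : I -> R -> R -> R -> R -> R) :
  (forall i, cont4 (G i)) -> cont4 (fun t chi th phi => \sum_i G i t chi th phi).
Proof.
move=> cG; apply: continuous_big => [|i _]; first exact: add_continuous.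
exact: cG.
Qed.

Lemma cont4_t (f : R -> R) : continuous f -> cont4 (fun t chi th phi => f t).
Proof.
move=> cf z; apply: (@continuous_comp _ _ _ (fun z : R * R * R * R => z.1.1.1) f); last exact: cf.
by move=> U HU; apply: (@cvg_fst _ _ _ _ _ (fst @^-1` (fst @^-1` U))); apply: cvg_fst; apply: cvg_fst.
Qed.

Lemma cont4_chi (f : R -> R) : continuous f -> cont4 (fun t chi th phi => f chi).
Proof.
move=> cf z; apply: (@continuous_comp _ _ _ (fun z : R * R * R * R => z.1.1.2) f); last exact: cf.
by move=> U HU; apply: (@cvg_fst _ _ _ _ _ (fst @^-1` (snd @^-1` U))); apply: cvg_fst; apply: cvg_snd.
Qed.

Lemma cont4_th (f : R -> R) : continuous f -> cont4 (fun t chi th phi => f th).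
Proof.
move=> cf z; apply: (@continuous_comp _ _ _ (fun z : R * R * R * R => z.1.2) f); last exact: cf.
by move=> U HU; apply: (@cvg_fst _ _ _ _ _ (snd @^-1` U)); apply: cvg_snd.
Qed.

Lemma cont4_phi (f : R -> R) : continuous f -> cont4 (fun t chi th phi => f phi).
Proof.
move=> cf z; apply: (@continuous_comp _ _ _ (fun z : R * R * R * R => z.2) f); last exact: cf.
exact: cvg_snd.
Qed.

Lemma continuous_sinh : continuous (@sinh R).
Proof.
move=> t; apply: differentiable_continuous; apply/derivable1_diffP.
exact: (@ex_derive _ _ _ _ _ _ _ (is_derive_sinh t)).
Qed.

Lemma continuous_cosh : continuous (@cosh R).
Proof.
move=> t; apply: differentiable_continuous; apply/derivable1_diffP.
exact: (@ex_derive _ _ _ _ _ _ _ (is_derive_cosh t)).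
Qed.

Let c_sinh := cont4_t continuous_sinh.
Let c_cosh := cont4_t continuous_cosh.
Let c_sinchi := cont4_chi (@continuous_sin R).
Let c_coschi := cont4_chi (@continuous_cos R).
Let c_sinth := cont4_th (@continuous_sin R).
Let c_costh := cont4_th (@continuous_cos R).
Let c_sinphi := cont4_phi (@continuous_sin R).
Let c_cosphi := cont4_phi (@continuous_cos R).

Lemma cont4_vm a : cont4 (fun t chi th phi => vm phi a).
Proof. by apply: cont4D; apply: cont4M => //; exact: cont4_cst. Qed.
Lemma cont4_em a : cont4 (fun t chi th phi => em phi a).
Proof. by apply: cont4B; apply: cont4M => //; exact: cont4_cst. Qed.
Lemma cont4_vn a : cont4 (fun t chi th phi => vn th phi a).
Proof.
by apply: cont4D; apply: cont4M => //; [exact: cont4_vm|exact: cont4_cst].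
Qed.
Lemma cont4_en a : cont4 (fun t chi th phi => en th phi a).
Proof.
by apply: cont4B; apply: cont4M => //; [exact: cont4_vm|exact: cont4_cst].
Qed.
Lemma cont4_vy a : cont4 (fun t chi th phi => vy chi th phi a).
Proof.
by apply: cont4D; apply: cont4M => //; [exact: cont4_vn|exact: cont4_cst].
Qed.
Lemma cont4_ey a : cont4 (fun t chi th phi => ey chi th phi a).
Proof.
by apply: cont4B; apply: cont4M => //; [exact: cont4_vn|exact: cont4_cst].
Qed.
Lemma cont4_vp a : cont4 (fun t chi th phi => vp t chi th phi a).
Proof.
by apply: cont4D; apply: cont4M => //; [exact: cont4_cst|exact: cont4_vy].
Qed.
Lemma cont4_ep a : cont4 (fun t chi th phi => ep t chi th phi a).
Proof.
by apply: cont4D; apply: cont4M => //; [exact: cont4_cst|exact: cont4_vy].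
Qed.

Lemma cont4_dS_point g : continuous g ->
  cont4 (fun t chi th phi => g (dS_point t chi th phi)).
Proof.
move=> cg z.
apply: (@continuous_comp _ _ _
  (fun z : R * R * R * R => dS_point z.1.1.1 z.1.1.2 z.1.2 z.2) g); last exact: cg.
apply: continuous_row => a; under eq_fun do rewrite dS_pointE.
exact: cont4_vp.
Qed.

Definition weight t chi th : R := cosh t ^+ 3 * sin chi ^+ 2 * sin th.

Lemma cont4_weight : cont4 (fun t chi th phi => weight t chi th).
Proof. by apply: cont4M => //; apply: cont4M => //; exact: cont4X. Qed.

Definition vanishes_far F : Prop :=
  exists r : R, forall x, deSitter x -> r < `|x| -> F x = 0.

Definition test_function F : Prop := smooth F /\ vanishes_far F.

Lemma dS_integralE F :
  dS_integral F =
  int_all (fun t chi th phi => F (dS_point t chi th phi) * weight t chi th).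
Proof. by []. Qed.

Lemma t_support_dS_point F : vanishes_far F ->
  t_support (fun t chi th phi => F (dS_point t chi th phi)).
Proof.
(* The factor 2 undoes the halving in [norm_sinh_ge]. *)
move=> [r Hr]; exists (2 * r) => t rt chi th phi; apply: Hr.
  exact: dS_point_deSitter.
have H0 : r < `|sinh t| by have := norm_sinh_ge t; lra.
apply: (lt_le_trans H0).
rewrite /Num.norm/= mx_normrE.
have -> : sinh t = dS_point t chi th phi 0 0 by rewrite mxE.
by apply: (le_bigmax _ (fun ij : 'I_1 * 'I_5 => `|dS_point t chi th phi ij.1 ij.2|) (0, 0)).
Qed.

Lemma t_supportMr A B : t_support A ->
  t_support (fun t chi th phi => A t chi th phi * B t chi th phi).
Proof. by move=> [T HT]; exists T => t tT *; rewrite HT// mul0r. Qed.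

Lemma cont4_test F : smooth F -> cont4 (fun t chi th phi =>
  F (dS_point t chi th phi) * weight t chi th).
Proof.
move=> Fs; apply: cont4M; last exact: cont4_weight.
exact/cont4_dS_point/smooth_continuous.
Qed.

Lemma t_support_test F : vanishes_far F -> t_support (fun t chi th phi =>
  F (dS_point t chi th phi) * weight t chi th).
Proof. by move=> ?; apply: t_supportMr; exact: t_support_dS_point. Qed.

Lemma dS_integral_eq F g : (forall x, deSitter x -> F x = g x) ->
  dS_integral F = dS_integral g.
Proof.
move=> Fg; rewrite !dS_integralE; apply: int_all_eq => *.
by rewrite Fg//; exact: dS_point_deSitter.
Qed.

Lemma dS_integralD F g : test_function F -> test_function g ->
  dS_integral (fun x => F x + g x) = dS_integral F + dS_integral g.
Proof.
move=> [Fs Ff] [gs gf]; rewrite !dS_integralE -int_allD; first last.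
- exact: t_support_test.
- exact: t_support_test.
- exact: cont4_test.
- exact: cont4_test.
by apply: int_all_eq => *; rewrite mulrDl.
Qed.

Lemma dS_integralZ (k : R) F : test_function F ->
  dS_integral (fun x => k * F x) = k * dS_integral F.
Proof.
move=> [Fs Ff]; rewrite !dS_integralE -int_allZ; first last.
- exact: t_support_test.
- exact: cont4_test.
by apply: int_all_eq => *; rewrite mulrA.
Qed.

Lemma dS_integral0 : dS_integral (fun _ => 0 : R) = 0.
Proof. by rewrite dS_integralE -[RHS]int_all0; apply: int_all_eq => * /=; rewrite mul0r. Qed.

(** The weight vanishes at the ends of the [chi] and [th] ranges, so the integral controls [F] only
    inside them; the ends follow by continuity in [th] and then in [chi]. *)
Lemma dS_integral_eq0 F : test_function F ->
  (forall x, deSitter x -> 0 <= F x) -> dS_integral F = 0 ->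
  forall x, deSitter x -> F x = 0.
Proof.
move=> [Fs Ff] F0 I0 x /dS_point_surj[t [chi [th [phi [hchi hth hphi ->]]]]].
have p0 := @pi_gt0 R.
have cF := cont4_dS_point (smooth_continuous Fs).
have Z := int_all_eq0 (cont4_test Fs) (t_support_test Ff) _ I0.
have {}Z : forall chi th, 0 < chi < pi -> 0 < th < pi ->
    F (dS_point t chi th phi) = 0.
  move=> chi' th' hchi' hth'.
  have /andP[c1 c2] := hchi'; have /andP[t1 t2] := hth'.
  have w0 : weight t chi' th' != 0.
    rewrite gt_eqF// mulr_gt0 ?sin_gt0_pi// mulr_gt0// exprn_gt0 ?cosh_gt0//.
    exact: sin_gt0_pi.
  apply/eqP; rewrite -(mulIr_eq0 _ (mulIf w0)); apply/eqP.
  apply: Z => //; rewrite ?ltW//.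
  move=> t' chi'' th'' phi' h1 h2; apply: mulr_ge0.
    exact/F0/dS_point_deSitter.
  by rewrite mulr_ge0 ?sin_ge0_pi// mulr_ge0 ?sqr_ge0// exprn_ge0// ltW// cosh_gt0.
have Zth : forall chi, 0 < chi < pi -> F (dS_point t chi th phi) = 0.
  move=> chi' hchi'.
  apply: (@continuous_eq0_itv _ 0 pi (fun th => F (dS_point t chi' th phi))) => //.
    move=> th'.
    apply: (@continuous_comp _ _ _ (fun th => (t, chi', th, phi))
     (fun z : R * R * R * R => F (dS_point z.1.1.1 z.1.1.2 z.1.2 z.2))); last exact: cF.
    exact: (cvg_pair (cvg_pair (cvg_cst (t, chi')) cvg_id) (cvg_cst phi)).
  by move=> th' hth'; exact: Z.
apply: (@continuous_eq0_itv _ 0 pi (fun chi => F (dS_point t chi th phi))) => //.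
move=> chi'.
apply: (@continuous_comp _ _ _ (fun chi => (t, chi, th, phi))
 (fun z : R * R * R * R => F (dS_point z.1.1.1 z.1.1.2 z.1.2 z.2))); last exact: cF.
exact: (cvg_pair (cvg_pair (cvg_pair (cvg_cst t) cvg_id) (cvg_cst th)) (cvg_cst phi)).
Qed.

End dS_integration.

(** * Integration by parts on the hyperboloid *)

Section divergence_theorem.
Context {R : realType}.
Local Notation V := 'rV[R]_5.
Local Notation e := (eta5 R).
Local Notation pi := (@pi R).
Implicit Types (t chi th phi : R) (a : 'I_5).

Lemma is_derive_vm a phi : is_derive phi (1 : R) (fun phi => vm phi a) (em phi a).
Proof. by apply: is_derive_eq; rewrite /GRing.scale/= /em; ring. Qed.

Lemma is_derive_em a phi : is_derive phi (1 : R) (fun phi => em phi a) (- vm phi a).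
Proof. by apply: is_derive_eq; rewrite /GRing.scale/= /vm; ring. Qed.

Lemma is_derive_vn a th phi : is_derive th (1 : R) (fun th => vn th phi a) (en th phi a).
Proof. by apply: is_derive_eq; rewrite /GRing.scale/= /en; ring. Qed.

Lemma is_derive_en a th phi : is_derive th (1 : R) (fun th => en th phi a) (- vn th phi a).
Proof. by apply: is_derive_eq; rewrite /GRing.scale/= /vn; ring. Qed.

Lemma is_derive_vy a chi th phi :
  is_derive chi (1 : R) (fun chi => vy chi th phi a) (ey chi th phi a).
Proof. by apply: is_derive_eq; rewrite /GRing.scale/= /ey; ring. Qed.

Lemma is_derive_ey a chi th phi :
  is_derive chi (1 : R) (fun chi => ey chi th phi a) (- vy chi th phi a).
Proof. by apply: is_derive_eq; rewrite /GRing.scale/= /vy; ring. Qed.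

Lemma is_derive_vp_t a t chi th phi :
  is_derive t (1 : R) (fun t => vp t chi th phi a) (ep t chi th phi a).
Proof. by apply: is_derive_eq; rewrite /GRing.scale/= /ep; ring. Qed.

Lemma is_derive_ep_t a t chi th phi :
  is_derive t (1 : R) (fun t => ep t chi th phi a) (vp t chi th phi a).
Proof. by apply: is_derive_eq; rewrite /GRing.scale/= /vp; ring. Qed.

Lemma is_derive_vp_chi a t chi th phi :
  is_derive chi (1 : R) (fun chi => vp t chi th phi a) (cosh t * ey chi th phi a).
Proof.
have d := is_derive_vy a chi th phi.
by apply: is_derive_eq; rewrite /GRing.scale/=; ring.
Qed.

Lemma is_derive_vp_th a t chi th phi :
  is_derive th (1 : R) (fun th => vp t chi th phi a)
    (cosh t * sin chi * en th phi a).
Proof.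
have d := is_derive_vn a th phi.
by apply: is_derive_eq; rewrite /GRing.scale/=; ring.
Qed.

Lemma is_derive_vp_phi a t chi th phi :
  is_derive phi (1 : R) (fun phi => vp t chi th phi a)
    (cosh t * sin chi * sin th * em phi a).
Proof.
have d := is_derive_vm a phi.
by apply: is_derive_eq; rewrite /GRing.scale/=; ring.
Qed.

Variables (g : V -> R) (a : 'I_5).
Hypothesis gt : test_function g.

Let gs : smooth g := gt.1.
Let gp t chi th phi := g (dS_point t chi th phi).
Let D b t chi th phi := partial b g (dS_point t chi th phi).

Let d_gp (c : R -> V) (v : 'I_5 -> R) (s : R) :
  (forall b, is_derive s (1 : R) (fun s => c s 0 b) (v b)) ->
  is_derive s (1 : R) (fun s => g (c s)) (\sum_b v b * partial b g (c s)).
Proof. by move=> dc; apply: is_derive_curve => //; exact: smooth_diff. Qed.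

(* The components [sqrt |g| W^i] of [W = g * theta_a], up to the sign [e a]. *)
Let flux_t t chi th phi : R :=
  gp t chi th phi * (cosh t ^+ 3 * sin chi ^+ 2 * sin th * ep t chi th phi a).
Let flux_chi t chi th phi : R :=
  gp t chi th phi * - (cosh t ^+ 2 * sin chi ^+ 2 * sin th * ey chi th phi a).
Let flux_th t chi th phi : R :=
  gp t chi th phi * - (cosh t ^+ 2 * sin chi * sin th * en th phi a).
Let flux_phi t chi th phi : R :=
  gp t chi th phi * - (cosh t ^+ 2 * sin chi * em phi a).

Let d_t t chi th phi : R :=
  gp t chi th phi * (3 * cosh t ^+ 2 * sinh t * sin chi ^+ 2 * sin th * ep t chi th phi a
    + cosh t ^+ 3 * sin chi ^+ 2 * sin th * vp t chi th phi a)
  + (cosh t ^+ 3 * sin chi ^+ 2 * sin th * ep t chi th phi a)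
    * \sum_b ep t chi th phi b * D b t chi th phi.
Let d_chi t chi th phi : R :=
  gp t chi th phi * (cosh t ^+ 2 * sin th *
    (sin chi ^+ 2 * vy chi th phi a - 2 * sin chi * cos chi * ey chi th phi a))
  + - (cosh t ^+ 2 * sin chi ^+ 2 * sin th * ey chi th phi a)
    * \sum_b cosh t * ey chi th phi b * D b t chi th phi.
Let d_th t chi th phi : R :=
  gp t chi th phi * (cosh t ^+ 2 * sin chi *
    (sin th * vn th phi a - cos th * en th phi a))
  + - (cosh t ^+ 2 * sin chi * sin th * en th phi a)
    * \sum_b cosh t * sin chi * en th phi b * D b t chi th phi.
Let d_phi t chi th phi : R :=
  gp t chi th phi * (cosh t ^+ 2 * sin chi * vm phi a)
  + - (cosh t ^+ 2 * sin chi * em phi a)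
    * \sum_b cosh t * sin chi * sin th * em phi b * D b t chi th phi.

Let is_d_t t chi th phi :
  is_derive t (1 : R) (fun t => flux_t t chi th phi) (d_t t chi th phi).
Proof.
have d1 : is_derive t (1 : R) (fun t => gp t chi th phi)
    (\sum_b ep t chi th phi b * D b t chi th phi).
  apply: (d_gp (c := fun t => dS_point t chi th phi)) => b.
  by under eq_fun do rewrite dS_pointE; exact: is_derive_vp_t.
have d2 := is_derive_ep_t a t chi th phi.
have d3 : is_derive t (1 : R)
    (fun t => cosh t ^+ 3 * sin chi ^+ 2 * sin th * ep t chi th phi a)
    (3 * cosh t ^+ 2 * sinh t * sin chi ^+ 2 * sin th * ep t chi th phi a
    + cosh t ^+ 3 * sin chi ^+ 2 * sin th * vp t chi th phi a).
  by apply: is_derive_eq; rewrite /GRing.scale/=; ring.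
exact: is_deriveM.
Qed.

Let is_d_chi t chi th phi :
  is_derive chi (1 : R) (fun chi => flux_chi t chi th phi) (d_chi t chi th phi).
Proof.
have d1 : is_derive chi (1 : R) (fun chi => gp t chi th phi)
    (\sum_b cosh t * ey chi th phi b * D b t chi th phi).
  apply: (d_gp (c := fun chi => dS_point t chi th phi)) => b.
  by under eq_fun do rewrite dS_pointE; exact: is_derive_vp_chi.
have d2 := is_derive_ey a chi th phi.
have d3 : is_derive chi (1 : R)
    (fun chi => - (cosh t ^+ 2 * sin chi ^+ 2 * sin th * ey chi th phi a))
    (cosh t ^+ 2 * sin th *
    (sin chi ^+ 2 * vy chi th phi a - 2 * sin chi * cos chi * ey chi th phi a)).
  by apply: is_derive_eq; rewrite /GRing.scale/=; ring.
exact: is_deriveM.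
Qed.

Let is_d_th t chi th phi :
  is_derive th (1 : R) (fun th => flux_th t chi th phi) (d_th t chi th phi).
Proof.
have d1 : is_derive th (1 : R) (fun th => gp t chi th phi)
    (\sum_b cosh t * sin chi * en th phi b * D b t chi th phi).
  apply: (d_gp (c := fun th => dS_point t chi th phi)) => b.
  by under eq_fun do rewrite dS_pointE; exact: is_derive_vp_th.
have d2 := is_derive_en a th phi.
have d3 : is_derive th (1 : R)
    (fun th => - (cosh t ^+ 2 * sin chi * sin th * en th phi a))
    (cosh t ^+ 2 * sin chi * (sin th * vn th phi a - cos th * en th phi a)).
  by apply: is_derive_eq; rewrite /GRing.scale/=; ring.
exact: is_deriveM.
Qed.

Let is_d_phi t chi th phi :
  is_derive phi (1 : R) (flux_phi t chi th) (d_phi t chi th phi).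
Proof.
have d1 : is_derive phi (1 : R) (fun phi => gp t chi th phi)
    (\sum_b cosh t * sin chi * sin th * em phi b * D b t chi th phi).
  apply: (d_gp (c := fun phi => dS_point t chi th phi)) => b.
  by under eq_fun do rewrite dS_pointE; exact: is_derive_vp_phi.
have d2 := is_derive_em a phi.
have d3 : is_derive phi (1 : R)
    (fun phi => - (cosh t ^+ 2 * sin chi * em phi a))
    (cosh t ^+ 2 * sin chi * vm phi a).
  by apply: is_derive_eq; rewrite /GRing.scale/=; ring.
exact: is_deriveM.
Qed.

(** The derivatives of [g] recombine into [dT a g] by [frame_complete]. The undifferentiated terms
    telescope: after [E1], [E2], [E3] the four fluxes give, up to weights, [4 vp - 3 vy],
    [3 vy - 2 vn], [2 vn - vm] and [vm], so that only [4 vp] remains. *)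
Let divergence_sum t chi th phi :
  (dT a g (dS_point t chi th phi) + 4 * (xlow (dS_point t chi th phi) a *
      g (dS_point t chi th phi))) * weight t chi th =
  e a * (d_t t chi th phi + (d_chi t chi th phi +
    (d_th t chi th phi + d_phi t chi th phi))).
Proof.
have EdT : dT a g (dS_point t chi th phi) = e a * \sum_b
    (ep t chi th phi a * ep t chi th phi b - ey chi th phi a * ey chi th phi b
     - en th phi a * en th phi b - em phi a * em phi b) * D b t chi th phi.
  rewrite /dT mulr_sumr; apply: eq_bigr => b _; rewrite mulrA; congr (_ * _).
  rewrite -frame_complete /theta /xlow !dS_pointE.
  have [<-|ab] := eqVneq a b.
    transitivity (e a * e a + e a * e a * e a * (vp t chi th phi a * vp t chi th phi a)).
      ring.
    by rewrite eta5_sqr mul1r; transitivity (e a * e a + e a * (vp t chi th phi a * vp t chi th phi a)); [rewrite eta5_sqr|ring].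
  transitivity (e b * e b * e a * (vp t chi th phi a * vp t chi th phi b)).
    ring.
  by rewrite eta5_sqr; ring.
rewrite EdT /xlow dS_pointE -/(gp t chi th phi) /d_t /d_chi /d_th /d_phi /weight.
pose S1 := \sum_b ep t chi th phi b * D b t chi th phi.
pose S2 := \sum_b ey chi th phi b * D b t chi th phi.
pose S3 := \sum_b en th phi b * D b t chi th phi.
pose S4 := \sum_b em phi b * D b t chi th phi.
have -> : \sum_b (ep t chi th phi a * ep t chi th phi b - ey chi th phi a * ey chi th phi b
     - en th phi a * en th phi b - em phi a * em phi b) * D b t chi th phi =
   ep t chi th phi a * S1 - ey chi th phi a * S2 - en th phi a * S3 - em phi a * S4.
  rewrite !mulr_sumr -!sumrB; apply: eq_bigr => b _.
  move: (D b t chi th phi) => *; ring.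
have -> : \sum_b cosh t * ey chi th phi b * D b t chi th phi = cosh t * S2.
  by rewrite mulr_sumr; apply: eq_bigr => b _; rewrite mulrA.
have -> : \sum_b cosh t * sin chi * en th phi b * D b t chi th phi =
    cosh t * sin chi * S3.
  by rewrite mulr_sumr; apply: eq_bigr => b _; rewrite mulrA.
have -> : \sum_b cosh t * sin chi * sin th * em phi b * D b t chi th phi =
    cosh t * sin chi * sin th * S4.
  by rewrite mulr_sumr; apply: eq_bigr => b _; rewrite mulrA.
have E1 : ep t chi th phi a * sinh t = cosh t * vp t chi th phi a - vy chi th phi a.
  apply: subr0_eq; transitivity ((1 + sinh t ^+ 2 - cosh t ^+ 2) * vy chi th phi a).
    by rewrite /ep /vp; ring.
  by rewrite cosh2_sinh2 subrr mul0r.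
have E2 : cos chi * ey chi th phi a = vn th phi a - sin chi * vy chi th phi a.
  apply: subr0_eq; transitivity ((cos chi ^+ 2 + sin chi ^+ 2 - 1) * vn th phi a).
    by rewrite /ey /vy; ring.
  by rewrite cos2Dsin2 subrr mul0r.
have E3 : cos th * en th phi a = vm phi a - sin th * vn th phi a.
  apply: subr0_eq; transitivity ((cos th ^+ 2 + sin th ^+ 2 - 1) * vm phi a).
    by rewrite /en /vn; ring.
  by rewrite cos2Dsin2 subrr mul0r.
rewrite -/S1.
rewrite (_ : 3 * cosh t ^+ 2 * sinh t * sin chi ^+ 2 * sin th * ep t chi th phi a =
  3 * cosh t ^+ 2 * sin chi ^+ 2 * sin th * (ep t chi th phi a * sinh t)); last by ring.
rewrite (_ : 2 * sin chi * cos chi * ey chi th phi a =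
  2 * sin chi * (cos chi * ey chi th phi a)); last by ring.
rewrite E1 E2 E3.
move: S1 S2 S3 S4 (gp t chi th phi) (ep _ _ _ _ _) (ey _ _ _ _) (en _ _ _) (em _ _)
  (vp _ _ _ _ _) (vy _ _ _ _) (vn _ _ _) (vm _ _) (cosh t) (sin chi) (sin th)
  => *; ring.
Qed.

Let c_gp : cont4 gp.
Proof. exact/cont4_dS_point/smooth_continuous. Qed.

Let c_D b : cont4 (D b).
Proof. exact/cont4_dS_point/smooth_continuous/smooth_partial. Qed.

Let c_cosh : cont4 (fun t _ _ _ => @cosh R t) := cont4_t (@continuous_cosh R).
Let c_sinh : cont4 (fun t _ _ _ => @sinh R t) := cont4_t (@continuous_sinh R).
Let c_sinchi : cont4 (fun _ chi _ _ => sin chi) := cont4_chi (@continuous_sin R).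
Let c_coschi : cont4 (fun _ chi _ _ => cos chi) := cont4_chi (@continuous_cos R).
Let c_sinth : cont4 (fun _ _ th _ => sin th) := cont4_th (@continuous_sin R).
Let c_costh : cont4 (fun _ _ th _ => cos th) := cont4_th (@continuous_cos R).

Ltac c4 := lazymatch goal with
  | |- cont4 (fun t c h p => @?A t c h p + @?B t c h p) =>
      apply: (@cont4D _ A B); c4
  | |- cont4 (fun t c h p => @?A t c h p * @?B t c h p) =>
      apply: (@cont4M _ A B); c4
  | |- cont4 (fun t c h p => - @?A t c h p) => apply: (@cont4N _ A); c4
  | |- cont4 (fun t c h p => @?A t c h p ^+ ?n) => apply: (@cont4X _ A n); c4
  | |- cont4 (fun t c h p => gp t c h p) => exact: c_gp
  | |- cont4 (fun t c h p => D _ t c h p) => exact: c_D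
  | |- cont4 (fun t c h p => cosh t) => exact: c_cosh
  | |- cont4 (fun t c h p => sinh t) => exact: c_sinh
  | |- cont4 (fun t c h p => sin c) => exact: c_sinchi
  | |- cont4 (fun t c h p => cos c) => exact: c_coschi
  | |- cont4 (fun t c h p => sin h) => exact: c_sinth
  | |- cont4 (fun t c h p => cos h) => exact: c_costh
  | |- cont4 (fun t c h p => ep t c h p _) => exact: cont4_ep
  | |- cont4 (fun t c h p => vp t c h p _) => exact: cont4_vp
  | |- cont4 (fun t c h p => ey c h p _) => exact: cont4_ey
  | |- cont4 (fun t c h p => vy c h p _) => exact: cont4_vy
  | |- cont4 (fun t c h p => en h p _) => exact: cont4_en
  | |- cont4 (fun t c h p => vn h p _) => exact: cont4_vn
  | |- cont4 (fun t c h p => em p _) => exact: cont4_em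
  | |- cont4 (fun t c h p => vm p _) => exact: cont4_vm
  | |- _ => first [exact: cont4_cst | apply: cont4_sum => ?; c4]
  end.

Let c_flux_t : cont4 flux_t. Proof. rewrite /flux_t; c4. Qed.
Let c_flux_chi : cont4 flux_chi. Proof. rewrite /flux_chi; c4. Qed.
Let c_flux_th : cont4 flux_th. Proof. rewrite /flux_th; c4. Qed.
Let c_d_t : cont4 d_t. Proof. rewrite /d_t; c4. Qed.
Let c_d_chi : cont4 d_chi. Proof. rewrite /d_chi; c4. Qed.
Let c_d_th : cont4 d_th. Proof. rewrite /d_th; c4. Qed.
Let c_d_phi : cont4 d_phi. Proof. rewrite /d_phi; c4. Qed.

Let s_gp : t_support gp.
Proof. exact/t_support_dS_point/gt.2. Qed.

Let is_derive_zero (h : R -> R) (s d : R) : (\forall u \near s, h u = 0) ->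
  is_derive s (1 : R) h d -> d = 0.
Proof.
move=> h0 dh; rewrite -(@derive_val _ _ _ _ _ _ _ dh) -(@derive_cst R R R 0 s 1).
exact: near_eq_derive.
Qed.

Let s_d_t : t_support d_t.
Proof.
have [T HT] := s_gp; exists T => t tT chi th phi.
apply: (is_derive_zero _ (is_d_t t chi th phi)).
have : \forall u \near t, T < `|u|.
  exact: (@cvgr_norm_gt _ _ _ (nbhs t) _ id t cvg_id _ tT).
by apply: (@filterS _ (nbhs t)) => u Tu; rewrite /flux_t HT// mul0r.
Qed.

Let s_d_chi : t_support d_chi.
Proof.
have [T HT] := s_gp; exists T => t tT chi th phi.
apply: (is_derive_zero _ (is_d_chi t chi th phi)).
by apply: (@nearW _ (nbhs chi)) => u; rewrite /flux_chi HT// mul0r.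
Qed.

Let s_d_th : t_support d_th.
Proof.
have [T HT] := s_gp; exists T => t tT chi th phi.
apply: (is_derive_zero _ (is_d_th t chi th phi)).
by apply: (@nearW _ (nbhs th)) => u; rewrite /flux_th HT// mul0r.
Qed.

Let s_d_phi : t_support d_phi.
Proof.
have [T HT] := s_gp; exists T => t tT chi th phi.
apply: (is_derive_zero _ (is_d_phi t chi th phi)).
by apply: (@nearW _ (nbhs phi)) => u; rewrite /flux_phi HT// mul0r.
Qed.

Let t_supportD (A B : R -> R -> R -> R -> R) : t_support A -> t_support B ->
  t_support (fun t chi th phi => A t chi th phi + B t chi th phi).
Proof.
move=> [T1 H1] [T2 H2]; exists (Num.max T1 T2) => t.
by rewrite gt_max => /andP[h1 h2] *; rewrite H1// H2// addr0.
Qed.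

Let dS_integral_div :
  dS_integral (fun x => dT a g x + 4 * (xlow x a * g x)) = 0.
Proof.
rewrite dS_integralE (int_all_eq divergence_sum).
have c1 := cont4D c_d_th c_d_phi; have s1 := t_supportD s_d_th s_d_phi.
have c2 := cont4D c_d_chi c1; have s2 := t_supportD s_d_chi s1.
have c3 := cont4D c_d_t c2; have s3 := t_supportD s_d_t s2.
rewrite int_allZ// int_allD// int_allD// int_allD//.
rewrite (int_all_dt c_flux_t c_d_t _ s_d_t is_d_t); last exact: t_supportMr.
rewrite (int_all_dchi c_flux_chi c_d_chi is_d_chi); last 2 first.
- by move=> *; rewrite /flux_chi sin0; ring.
- by move=> *; rewrite /flux_chi sinpi; ring.
rewrite (int_all_dth c_flux_th c_d_th is_d_th); last 2 first.
- by move=> *; rewrite /flux_th sin0; ring.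
- by move=> *; rewrite /flux_th sinpi; ring.
(* The [phi] flux need not vanish at the ends; periodicity makes its two end values equal. *)
rewrite (int_all_dphi c_d_phi is_d_phi) ?addr0 ?mulr0// => t chi th.
have c2pi : cos (2 * pi) = cos 0 by rewrite mulr_natl cos2pi cos0.
have s2pi : sin (2 * pi) = sin 0 by rewrite mulr_natl sin2pi sin0.
by rewrite /flux_phi /gp /dS_point /em c2pi s2pi.
Qed.

Lemma vanishes_far_dT : vanishes_far (dT a g).
Proof.
have [r Hr] := gt.2; exists r => x xS rx; apply: dT_near_eq0 => //.
have : \forall y \near x, r < `|y|.
  exact: (@cvgr_norm_gt _ _ _ (nbhs x) _ id x cvg_id _ rx).
by apply: (@filterS _ (nbhs x)) => y ry yS; exact: Hr.
Qed.

Lemma test_function_dT : test_function (dT a g).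
Proof. by split; [exact: smooth_dT|exact: vanishes_far_dT]. Qed.

Lemma dS_integral_dT :
  dS_integral (dT a g) = - 4 * dS_integral (fun x => xlow x a * g x).
Proof.
have tx : test_function (fun x => xlow x a * g x).
  split; first by apply: smoothM => //; exact: smooth_xlow.
  by have [r Hr] := gt.2; exists r => x xS rx; rewrite Hr// mulr0.
have t4 : test_function (fun x => 4 * (xlow x a * g x)).
  split; first by apply: smoothM tx.1; exact: smooth_cst.
  by have [r Hr] := tx.2; exists r => x xS rx; rewrite Hr// mulr0.
have := dS_integral_div; rewrite dS_integralD//; last exact: test_function_dT.
rewrite dS_integralZ// => /eqP; rewrite addr_eq0 => /eqP ->.
by rewrite mulNr.
Qed.

End divergence_theorem.

(** * The quadratic part of the action *)

Section test_functions.
Context {R : realType}.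
Local Notation V := 'rV[R]_5.
Local Notation e := (eta5 R).
Implicit Types (g h : V -> R) (x : V).

Lemma test_functionMl h g : smooth h -> test_function g ->
  test_function (fun x => h x * g x).
Proof.
move=> hs [gs [r Hr]]; split; first exact: smoothM.
by exists r => x xS rx; rewrite Hr// mulr0.
Qed.

Lemma test_functionZ (k : R) g : test_function g ->
  test_function (fun x => k * g x).
Proof. by apply: test_functionMl; exact: smooth_cst. Qed.

Lemma test_function0 : test_function (fun _ : V => 0 : R).
Proof. by split; [exact: smooth_cst|exists 0]. Qed.

Lemma test_functionD g h : test_function g -> test_function h ->
  test_function (fun x => g x + h x).
Proof.
move=> [gs [r Hr]] [hs [r' Hr']]; split; first exact: smoothD.
exists (Num.max r r') => x xS; rewrite gt_max => /andP[rx rx'].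
by rewrite Hr// Hr'// addr0.
Qed.

Lemma test_functionB g h : test_function g -> test_function h ->
  test_function (fun x => g x - h x).
Proof.
move=> gt ht; rewrite (_ : (fun x => _) = fun x => g x + -1 * h x).
  by apply: test_functionD => //; exact: test_functionZ.
by apply/funext => x; rewrite mulN1r.
Qed.

Lemma test_function_sum (I : finType) (F : I -> V -> R) :
  (forall i, test_function (F i)) -> test_function (fun x => \sum_i F i x).
Proof.
move=> Ft; elim: (index_enum I) => [|i r IH].
  by under eq_fun do rewrite big_nil; exact: test_function0.
by under eq_fun do rewrite big_cons; exact: test_functionD.
Qed.

Lemma dS_integral_sum (I : finType) (F : I -> V -> R) :
  (forall i, test_function (F i)) ->
  dS_integral (fun x => \sum_i F i x) = \sum_i dS_integral (F i).
Proof.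
move=> Ft; suff H (r : seq I) : test_function (fun x => \sum_(i <- r) F i x) /\
    dS_integral (fun x => \sum_(i <- r) F i x) = \sum_(i <- r) dS_integral (F i).
  exact: (H _).2.
elim: r => [|i r [IHt IH]].
  split; first by under eq_fun do rewrite big_nil; exact: test_function0.
  by under eq_fun do rewrite big_nil; rewrite big_nil dS_integral0.
split; first by under eq_fun do rewrite big_cons; exact: test_functionD.
by under eq_fun do rewrite big_cons; rewrite dS_integralD// IH big_cons.
Qed.

(** [hexp 1] is the standard [exp (-1/u)]. The Euclidean square is taken because [mdot x x] is
    constant on the hyperboloid and would localize nothing. *)
Definition cutoff (r : R) x : R := hexp 1 (r - \sum_a x 0 a ^+ 2).

Lemma smooth_cutoff r : smooth (cutoff r).
Proof.
apply: smooth_hexp; apply: smoothB; first exact: smooth_cst.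
apply: smooth_sum => a; under eq_fun do rewrite expr2.
by apply: smoothM; exact: smooth_coord.
Qed.

Lemma cutoff_ge0 r x : 0 <= cutoff r x.
Proof.
by rewrite /cutoff /hexp; case: ifP => // _; rewrite hornerE mul1r expR_ge0.
Qed.

Lemma cutoff_gt0 r x : \sum_a x 0 a ^+ 2 < r -> 0 < cutoff r x.
Proof. by move=> xr; rewrite /cutoff /hexp subr_gt0 xr hornerE mul1r expR_gt0. Qed.

(** [|x|] is the maximum norm, so some coordinate has square above [(r + 1)^2], which exceeds
    [r]. *)
Lemma cutoff_eq0 r x : 0 < r -> r + 1 < `|x| -> cutoff r x = 0.
Proof.
move=> r0 rx; rewrite /cutoff /hexp ifF//; apply/negbTE; rewrite -leNgt subr_le0.
have n0 : mx_norm x != 0.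
  by rewrite gt_eqF//; apply: (le_lt_trans _ rx); rewrite addr_ge0// ltW.
have [[i a] /= E] := mx_norm_neq0 n0.
rewrite (ord1 i) in E; rewrite /Num.norm/= E in rx.
rewrite (bigD1 a)//=; apply: (@le_trans _ _ (x 0 a ^+ 2)).
  rewrite -real_normK ?num_real//; nra.
by rewrite lerDl sumr_ge0// => b _; exact: sqr_ge0.
Qed.

End test_functions.

(** * Expansion of the action around a scaled field *)

Section free_action.
Context {R : realType}.
Local Notation V := 'rV[R]_5.
Local Notation e := (eta5 R).
Implicit Types (x : V) (K L dK : gauge_field R) (a b : 'I_5) (A : 'I_10) (s u : R).
Variables (f : 'I_10 -> 'I_10 -> 'I_10 -> R) (q : 'M[R]_10).

Local Notation tensor := ('I_5 -> 'I_5 -> 'I_10 -> V -> R).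
Implicit Types U W : tensor.

(** The polarized Lagrangian: [lagrangian f q K] is convertible with it when the curvature fills
    both slots. *)
Definition quad U W x : R := \sum_(a < 5) \sum_(b < 5) \sum_(A < 10) \sum_(B < 10)
  U a b A x * q A B * (e a * e b * W a b B x).

(** Both orders appear since [q] may fail to be symmetric; this is how [q + q^T] enters. *)
Definition quad_sym U W x := quad U W x + quad W U x.

(** A single sum over index quadruples lets polynomial identities be checked summand by summand. *)
Lemma quadE U W x : quad U W x = \sum_(i : 'I_5 * 'I_5 * 'I_10 * 'I_10)
  U i.1.1.1 i.1.1.2 i.1.2 x * q i.1.2 i.2 *
    (e i.1.1.1 * e i.1.1.2 * W i.1.1.1 i.1.1.2 i.2 x).
Proof.
rewrite /quad pair_big pair_big pair_big/=.
by apply: eq_bigr => -[[[]]].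
Qed.

Lemma smooth_quad_test U W : (forall a b A, smooth (U a b A)) ->
  (forall a b A, test_function (W a b A)) -> test_function (quad U W).
Proof.
move=> Us Wt; rewrite (funext (quadE U W)).
apply: test_function_sum => i; apply: test_functionMl.
  by apply: smoothM => //; exact: smooth_cst.
exact: test_functionZ.
Qed.

Lemma test_quad_smooth U W : (forall a b A, test_function (U a b A)) ->
  (forall a b A, smooth (W a b A)) -> test_function (quad U W).
Proof.
move=> Ut Ws; rewrite (_ : quad U W = fun x =>
  \sum_(i : 'I_5 * 'I_5 * 'I_10 * 'I_10) (q i.1.2 i.2 * (e i.1.1.1 * e i.1.1.2)) *
    (W i.1.1.1 i.1.1.2 i.2 x * U i.1.1.1 i.1.1.2 i.1.2 x)).
  apply: test_function_sum => i; apply: test_functionZ.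
  exact: test_functionMl.
apply/funext => x; rewrite quadE; apply: eq_bigr => i _; ring.
Qed.

Lemma quad_sym_test U W : (forall a b A, smooth (U a b A)) ->
  (forall a b A, test_function (W a b A)) -> test_function (quad_sym U W).
Proof.
by move=> Us Wt; apply: test_functionD; [exact: smooth_quad_test|exact: test_quad_smooth].
Qed.

Definition free_curvature K a b A : V -> R := field_strength (K A) a b.

(** The commutator term of the curvature, polarized so that its cross terms in [K] and [dK] have
    names. *)
Definition self_coupling K L a b A x : R :=
  \sum_(B < 10) \sum_(C < 10) K B b x * L C a x * f B C A.

Lemma curvatureE K a b A x :
  curvature f K a b A x = free_curvature K a b A x + self_coupling K K a b A x.
Proof. by []. Qed.

Lemma free_curvature_lin K L s u a b A x : smooth_field K -> smooth_field L ->
  free_curvature (fadd (fscale s K) (fscale u L)) a b A x =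
  s * free_curvature K a b A x + u * free_curvature L a b A x.
Proof.
move=> Ks Ls.
have E c d : dT c (fadd (fscale s K) (fscale u L) A d) x =
    s * dT c (K A d) x + u * dT c (L A d) x.
  have sK : smooth (fscale s K A d) by apply: smoothM; [exact: smooth_cst|].
  have sL : smooth (fscale u L A d) by apply: smoothM; [exact: smooth_cst|].
  rewrite /fadd (dTD _ sK sL) /fscale (dTZ _ _ (Ks A d)) (dTZ _ _ (Ls A d)).
  by [].
rewrite /free_curvature /field_strength /nablaT !E /fadd /fscale.
move: (dT a (K A b) x) (dT b (K A a) x) (dT a (L A b) x) (dT b (L A a) x) => *.
ring.
Qed.

Lemma free_curvatureZ K s a b A x : smooth_field K ->
  free_curvature (fscale s K) a b A x = s * free_curvature K a b A x.
Proof.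
move=> Ks.
have E c d : dT c (fscale s K A d) x = s * dT c (K A d) x.
  by rewrite /fscale (dTZ _ _ (Ks A d)).
rewrite /free_curvature /field_strength /nablaT !E /fscale.
move: (dT a (K A b) x) (dT b (K A a) x) => *; ring.
Qed.

Lemma self_couplingZ K s a b A x :
  self_coupling (fscale s K) (fscale s K) a b A x = s ^+ 2 * self_coupling K K a b A x.
Proof.
rewrite /self_coupling mulr_sumr; apply: eq_bigr => B _; rewrite mulr_sumr.
by apply: eq_bigr => C _; rewrite /fscale; ring.
Qed.

Lemma self_coupling_lin K L s u a b A x :
  self_coupling (fadd (fscale s K) (fscale u L)) (fadd (fscale s K) (fscale u L)) a b A x =
  s ^+ 2 * self_coupling K K a b A x
  + s * u * (self_coupling K L a b A x + self_coupling L K a b A x)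
  + u ^+ 2 * self_coupling L L a b A x.
Proof.
rewrite /self_coupling -big_split/= !mulr_sumr -!big_split/=.
apply: eq_bigr => B _; rewrite -big_split/= !mulr_sumr -!big_split/=.
by apply: eq_bigr => C _; rewrite /fadd /fscale; ring.
Qed.

Lemma smooth_free_curvature K a b A : smooth_field K -> smooth (free_curvature K a b A).
Proof. by move=> Ks; apply: smooth_field_strength => c; exact: Ks. Qed.

Lemma smooth_self_coupling K L a b A : smooth_field K -> smooth_field L ->
  smooth (self_coupling K L a b A).
Proof.
move=> Ks Ls; apply: smooth_sum => B; apply: smooth_sum => C.
by apply: smoothM; [apply: smoothM; [exact: Ks|exact: Ls]|exact: smooth_cst].
Qed.

Section variation.
Variables K dK : gauge_field R.
Hypothesis Ks : smooth_field K.
Hypothesis dKt : forall A a, test_function (dK A a).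

Let dKs : smooth_field dK. Proof. by move=> A a; have [] := dKt A a. Qed.

Let F := free_curvature K.
Let N := self_coupling K K.
Let G := free_curvature dK.
Let M a b A x := self_coupling K dK a b A x + self_coupling dK K a b A x.
Let N2 := self_coupling dK dK.

Let Fs a b A : smooth (F a b A). Proof. exact: smooth_free_curvature. Qed.
Let Ns a b A : smooth (N a b A). Proof. exact: smooth_self_coupling. Qed.

Let Gt a b A : test_function (G a b A).
Proof.
have nt c d : test_function (nablaT c (dK A) d).
  apply: test_functionB; first exact: test_function_dT.
  by apply: test_functionMl => //; exact: smooth_xlow.
exact: test_functionB.
Qed.

Let couplingt L a b A : smooth_field L -> test_function (self_coupling L dK a b A).
Proof.
move=> Ls; rewrite (_ : self_coupling L dK a b A = fun x =>
    \sum_(B < 10) \sum_(C < 10) f B C A * (L B b x * dK C a x)).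
  apply: test_function_sum => B; apply: test_function_sum => C.
  by apply/test_functionZ/test_functionMl => //; exact: Ls.
apply/funext => x; apply: eq_bigr => B _; apply: eq_bigr => C _; ring.
Qed.

Let Mt a b A : test_function (M a b A).
Proof.
apply: test_functionD; first exact: couplingt.
rewrite (_ : self_coupling dK K a b A = fun x =>
    \sum_(B < 10) \sum_(C < 10) f B C A * (K C a x * dK B b x)).
  apply: test_function_sum => B; apply: test_function_sum => C.
  by apply/test_functionZ/test_functionMl => //; exact: Ks.
apply/funext => x; apply: eq_bigr => B _; apply: eq_bigr => C _; ring.
Qed.

Let N2t a b A : test_function (N2 a b A). Proof. exact: couplingt. Qed.

(** The curvature of [s K + u dK] is quadratic in [u]; [R0] and [R1] are its coefficients of degree
    0 and 1, and [N2] is that of degree 2. *)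
Let R0 (s : R) a b A x : R := s * F a b A x + s ^+ 2 * N a b A x.
Let R1 (s : R) a b A x : R := G a b A x + s * M a b A x.

Let curv0 s a b A x : curvature f (fscale s K) a b A x = R0 s a b A x.
Proof. by rewrite curvatureE free_curvatureZ// self_couplingZ. Qed.

Let curv1 s u a b A x :
  curvature f (fadd (fscale s K) (fscale u dK)) a b A x =
  R0 s a b A x + u * R1 s a b A x + u ^+ 2 * N2 a b A x.
Proof.
rewrite curvatureE free_curvature_lin// self_coupling_lin /R0 /R1 -/(M a b A x).
rewrite -/(F a b A x) -/(G a b A x) -/(N a b A x) -/(N2 a b A x).
move: (F a b A x) (G a b A x) (N a b A x) (N2 a b A x) (M a b A x) => *; ring.
Qed.

(* [P1], [P2], [P3] are the coefficients of [u s], [u s^2], [u s^3] in the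
   variation of the Lagrangian; [Q2], [Q3], [Q4] are those of higher powers of
   [u]. *)
Let P1 := quad_sym F G.
Let P2 x := quad_sym F M x + quad_sym N G x.
Let P3 := quad_sym N M.
Let Q2 s x := quad_sym (R0 s) N2 x + quad (R1 s) (R1 s) x.
Let Q3 s := quad_sym (R1 s) N2.
Let Q4 := quad N2 N2.

Let lagrangian_expansion s u x :
  lagrangian f q (fadd (fscale s K) (fscale u dK)) x - lagrangian f q (fscale s K) x =
  u * (s * P1 x + (s ^+ 2 * P2 x + s ^+ 3 * P3 x)) +
  (u ^+ 2 * Q2 s x + (u ^+ 3 * Q3 s x + u ^+ 4 * Q4 x)).
Proof.
rewrite -[lagrangian f q (fscale s K) x]/(quad _ _ x).
rewrite -[lagrangian f q _ x]/(quad _ _ x).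
rewrite /P1 /P2 /P3 /Q2 /Q3 /Q4 /quad_sym !quadE.
rewrite -!big_split/= !mulr_sumr -!big_split/= !mulr_sumr -sumrB -!big_split/=.
apply: eq_bigr => -[[[a b] A] B] _ /=; rewrite !curv0 !curv1 /R0 /R1.
move: (F a b A x) (F a b B x) (N a b A x) (N a b B x) (G a b A x) (G a b B x)
  (M a b A x) (M a b B x) (N2 a b A x) (N2 a b B x) (q A B) (e a) (e b) => *.
ring.
Qed.

Let R0s s a b A : smooth (R0 s a b A).
Proof.
by apply: smoothD; apply: smoothM; [exact: smooth_cst|exact: Fs|exact: smooth_cst|exact: Ns].
Qed.

Let R1t s a b A : test_function (R1 s a b A).
Proof. by apply: test_functionD => //; exact: test_functionZ. Qed.

Let P1t : test_function P1. Proof. exact: quad_sym_test. Qed.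
Let P2t : test_function P2.
Proof. by apply: test_functionD; exact: quad_sym_test. Qed.
Let P3t : test_function P3. Proof. exact: quad_sym_test. Qed.
Let Q2t s : test_function (Q2 s).
Proof.
apply: test_functionD; first exact: quad_sym_test.
by apply: smooth_quad_test => // a b A; exact: (R1t s a b A).1.
Qed.
Let Q3t s : test_function (Q3 s).
Proof. by apply: quad_sym_test => // a b A; exact: (R1t s a b A).1. Qed.
Let Q4t : test_function Q4.
Proof. by apply: smooth_quad_test => // a b A; exact: (N2t a b A).1. Qed.

(** Each coefficient contains the compactly supported variation, so it is a test function by itself
    and the integral may be split term by term. *)
Let action_diff_expansion s u :
  action_diff f q (fadd (fscale s K) (fscale u dK)) (fscale s K) =
  u * (s * dS_integral P1 + (s ^+ 2 * dS_integral P2 + s ^+ 3 * dS_integral P3)) +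
  (u ^+ 2 * dS_integral (Q2 s) + (u ^+ 3 * dS_integral (Q3 s) + u ^+ 4 * dS_integral Q4)).
Proof.
rewrite /action_diff (dS_integral_eq (fun x _ => lagrangian_expansion s u x)).
have Z (k : R) g : test_function g -> test_function (fun x => k * g x).
  exact: test_functionZ.
have t1 := test_functionD (Z (s ^+ 2) _ P2t) (Z (s ^+ 3) _ P3t).
have t2 := test_functionD (Z s _ P1t) t1.
have t3 := test_functionD (Z (u ^+ 3) _ (Q3t s)) (Z (u ^+ 4) _ Q4t).
have t4 := test_functionD (Z (u ^+ 2) _ (Q2t s)) t3.
rewrite (dS_integralD (Z u _ t2) t4) (dS_integralZ _ t2).
rewrite (dS_integralD (Z s _ P1t) t1) (dS_integralD (Z (s ^+ 2) _ P2t) (Z (s ^+ 3) _ P3t)).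
rewrite (dS_integralD (Z (u ^+ 2) _ (Q2t s)) t3).
rewrite (dS_integralD (Z (u ^+ 3) _ (Q3t s)) (Z (u ^+ 4) _ Q4t)).
by rewrite !dS_integralZ.
Qed.

Lemma first_variationE s : first_variation f q (fscale s K) dK =
  s * dS_integral P1 + (s ^+ 2 * dS_integral P2 + s ^+ 3 * dS_integral P3).
Proof.
rewrite /first_variation derive1E.
under eq_fun do rewrite action_diff_expansion.
move: (_ + _) (dS_integral (Q2 s)) (dS_integral (Q3 s)) (dS_integral Q4) => c1 c2 c3 c4.
have d : is_derive (0 : R) (1 : R)
    (fun u : R => u * c1 + (u ^+ 2 * c2 + (u ^+ 3 * c3 + u ^+ 4 * c4))) c1.
  by apply: is_derive_eq; rewrite /GRing.scale/=; ring.
exact: (@derive_val _ _ _ _ _ _ _ d).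
Qed.

(** Only free curvatures enter [P1]: in the coefficient of [u], every contribution of the structure
    constants carries [s^2] or [s^3]. The linear equation is thus that of the abelian theory. *)
Lemma is_derive_first_variation :
  is_derive (0 : R) (1 : R) (fun s : R => first_variation f q (fscale s K) dK)
    (dS_integral P1).
Proof.
under eq_fun do rewrite first_variationE.
move: (dS_integral P1) (dS_integral P2) (dS_integral P3) => c1 c2 c3.
by apply: is_derive_eq; rewrite /GRing.scale/=; ring.
Qed.

End variation.

End free_action.

(** * Pairing the free Euler-Lagrange expression with a variation *)

Section field_equation.
Context {R : realType}.
Local Notation V := 'rV[R]_5.
Local Notation e := (eta5 R).
Implicit Types (x : V) (a b : 'I_5) (A B : 'I_10).
Variables (q : 'M[R]_10) (K : gauge_field R).
Hypotheses (Ks : smooth_field K) (Kt : transverse K).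

Let M := q + q^T.

(* Contracting the Lie-algebra index with the symmetrized form reduces the
   pairing of two gauge fields to pairings of single vector fields. *)
Definition lower_index : gauge_field R :=
  fun B a x => \sum_A M A B * K A a x.

Local Notation K' := lower_index.

Lemma smooth_lower_index B a : smooth (K' B a).
Proof. by apply: smooth_sum => A; apply: smoothM; [exact: smooth_cst|exact: Ks]. Qed.

Lemma transverse_lower_index : transverse K'.
Proof.
move=> x xS B; under eq_bigr do rewrite mulr_sumr.
rewrite exchange_big/= big1// => A _.
transitivity (M A B * \sum_a x 0 a * K A a x).
  by rewrite mulr_sumr; apply: eq_bigr => a _; ring.
by rewrite Kt// mulr0.
Qed.

Let dT_lower B a b x : dT a (K' B b) x = \sum_A M A B * dT a (K A b) x.
Proof.
rewrite /K' dT_sum; last by move=> A; apply: smoothM; [exact: smooth_cst|exact: Ks].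
by apply: eq_bigr => A _; rewrite (dTZ _ _ (Ks A b)).
Qed.

Lemma field_strength_lower B a b x :
  field_strength (K' B) a b x = \sum_A M A B * field_strength (K A) a b x.
Proof.
rewrite /field_strength /nablaT !dT_lower /K' !mulr_sumr -!sumrB.
apply: eq_bigr => A _.
move: (dT a (K A b) x) (dT b (K A a) x) => *; ring.
Qed.

Lemma EL_lower B a x : EL_field (K' B) a x = \sum_A M A B * EL_field (K A) a x.
Proof.
have dTd c b y : dT c (fun y => \sum_A M A B * dT c (K A b) y) y =
    \sum_A M A B * dT c (dT c (K A b)) y.
  have sd A : smooth (dT c (K A b)) by apply: smooth_dT; exact: Ks.
  rewrite dT_sum; last by move=> A; apply: smoothM => //; exact: smooth_cst.
  by apply: eq_bigr => A _; rewrite dTZ.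
have fE b c : dT c (K' B b) = fun y => \sum_A M A B * dT c (K A b) y.
  by apply/funext => y; exact: dT_lower.
have EQ b y : Q0 (K' B b) y = \sum_A M A B * Q0 (K A b) y.
  rewrite /Q0; under [in RHS]eq_bigr do rewrite mulrN mulr_sumr.
  rewrite sumrN exchange_big/=; congr (- _); apply: eq_bigr => c _.
  rewrite fE dTd mulr_sumr.
  by apply: eq_bigr => A _; ring.
have Ediv : divT (K' B) = fun y => \sum_A M A B * divT (K A) y.
  apply/funext => y; rewrite /divT; under [in RHS]eq_bigr do rewrite mulr_sumr.
  rewrite exchange_big/=; apply: eq_bigr => c _; rewrite fE mulr_sumr.
  by apply: eq_bigr => A _; ring.
have Edd : dT a (divT (K' B)) x = \sum_A M A B * dT a (divT (K A)) x.
  have ds A : smooth (divT (K A)) by apply: smooth_divT => c; exact: Ks.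
  rewrite Ediv dT_sum; last by move=> A; apply: smoothM; [exact: smooth_cst|].
  by apply: eq_bigr => A _; rewrite dTZ.
rewrite /EL_field EQ Edd Ediv /K' !mulr_sumr -sumrN -big_split/= -!sumrB.
apply: eq_bigr => A _.
move: (Q0 _ _) (dT _ _ _) (divT _ _) => *; ring.
Qed.

Definition EL_pairing (dK : gauge_field R) x : R :=
  \sum_B \sum_b e b * (EL_field (K' B) b x * dK B b x).

Variable dK : gauge_field R.
Hypotheses (dKt : forall A a, test_function (dK A a)) (dKtr : transverse dK).

Let dKs A a : smooth (dK A a). Proof. by have [] := dKt A a. Qed.

Lemma quad_sym_lower x :
  quad_sym q (free_curvature K) (free_curvature dK) x =
  \sum_B \sum_a \sum_b e a * e b *
    (field_strength (K' B) a b x * field_strength (dK B) a b x).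
Proof.
rewrite /quad_sym /quad /free_curvature -big_split/=.
rewrite [RHS]exchange_big/=; apply: eq_bigr => a _.
rewrite [RHS]exchange_big/= -big_split/=; apply: eq_bigr => b _.
(* Interchanging the two Lie-algebra sums in the first half makes the index of [dK] the outer one in
   both halves; the second half then carries [q^T]. *)
rewrite [X in X + _]exchange_big/=.
rewrite -big_split/=; apply: eq_bigr => B _.
rewrite -big_split/= field_strength_lower mulr_suml mulr_sumr; apply: eq_bigr => A _.
rewrite /M !mxE; move: (field_strength _ _ _ _) (field_strength _ _ _ _) => *; ring.
Qed.

Let flux_test B a : test_function (flux (K' B) (dK B) a).
Proof.
apply: test_function_sum => b; apply/test_functionZ/test_functionMl => //.
by apply: smooth_field_strength => c; exact: smooth_lower_index.
Qed.

Lemma EL_pairing_test : test_function (EL_pairing dK).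
Proof.
apply: test_function_sum => B; apply: test_function_sum => b.
apply/test_functionZ/test_functionMl => //.
have s := smooth_field_expr B b smooth_lower_index.
exact: s.
Qed.

(** The total divergence integrates to zero: [dS_integral_dT] replaces each [dT^a flux_a] by
    [-4 x^a flux_a], and [flux] is tangent. *)
Lemma dS_integral_pairing :
  dS_integral (quad_sym q (free_curvature K) (free_curvature dK)) =
  - 2 * dS_integral (EL_pairing dK).
Proof.
pose D x := \sum_B \sum_a e a * dT a (flux (K' B) (dK B) a) x.
have Dt : test_function D.
  apply: test_function_sum => B; apply: test_function_sum => a.
  by apply: test_functionZ; exact: test_function_dT.
have E x : deSitter x -> quad_sym q (free_curvature K) (free_curvature dK) x =
    2 * D x + - 2 * EL_pairing dK x.
  move=> xS; rewrite quad_sym_lower /D /EL_pairing !mulr_sumr -big_split/=.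
  apply: eq_bigr => B _; rewrite field_strength_pairing ?mulNr//.
  - exact: smooth_lower_index.
  - by move=> y yS; exact: transverse_lower_index.
  - by move=> y yS; exact: dKtr.
rewrite (dS_integral_eq E) dS_integralD; last 2 first.
- exact: test_functionZ.
- exact/test_functionZ/EL_pairing_test.
rewrite (dS_integralZ _ Dt) (dS_integralZ _ EL_pairing_test).
suff -> : dS_integral D = 0 by rewrite mulr0 add0r.
have tB B a : test_function (fun x => e a * dT a (flux (K' B) (dK B) a) x).
  by apply: test_functionZ; exact: test_function_dT.
rewrite /D dS_integral_sum; last by move=> B; exact: test_function_sum.
rewrite big1// => B _; rewrite dS_integral_sum//.
have tx a : test_function (fun x => x 0 a * flux (K' B) (dK B) a x).
  by apply: test_functionMl => //; exact: smooth_coord.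
transitivity (- 4 * \sum_a dS_integral (fun x => x 0 a * flux (K' B) (dK B) a x)).
  rewrite mulr_sumr; apply: eq_bigr => a _.
  rewrite dS_integralZ; last exact: test_function_dT.
  rewrite dS_integral_dT// (_ : (fun x => xlow x a * _) =
      fun x => e a * (x 0 a * flux (K' B) (dK B) a x)); last first.
    by apply/funext => x; rewrite /xlow mulrA.
  rewrite dS_integralZ//.
  transitivity (e a * e a * (-4 * dS_integral (fun x => x 0 a * flux (K' B) (dK B) a x))).
    move: (dS_integral _) => *; ring.
  by rewrite eta5_sqr mul1r.
rewrite -dS_integral_sum// (@dS_integral_eq _ _ (fun=> 0)) ?dS_integral0 ?mulr0//.
move=> x xS; apply: sum_x_flux => //.
- exact: smooth_lower_index.
- by move=> y yS; exact: transverse_lower_index.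
Qed.

End field_equation.

(** * From the equation tested on variations to pointwise equations *)

Theorem mainTheorem1 (R : realType) (X : 'I_10 -> 'M[R]_5)
    (f : 'I_10 -> 'I_10 -> 'I_10 -> R) (q : 'M[R]_10) (K : gauge_field R)
    (hX : so14_generators X) (hf : structure_constants X f)
    (hq : q + q^T \in unitmx)
    (hKs : smooth_field K) (hKt : transverse K) :
  [/\ (* the linear field equation, as an equation in the space of transverse
         fields: only components tangent to the hyperboloid are tested *)
      linear_field_equation f q K <->
        (forall x, deSitter x -> forall A a,
           \sum_(b < 5) theta x a b * (eta5 R b * field_expr K A b x) = 0),
      (* all five ambient components *)
      (forall x, deSitter x -> forall A a, field_expr K A a x = 0) <->
        (linear_field_equation f q K /\ divergenceless K)
    & divergenceless K ->
        ((forall x, deSitter x -> forall A a, field_expr K A a x = 0) <->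
         (forall x, deSitter x -> forall A a,
            Q0 (K A a) x - 2 * K A a x = 0))].
Proof.
have hT A : forall x, deSitter x -> \sum_a x 0 a * K A a x = 0.
  by move=> x xS; exact: hKt.
pose M := q + q^T.
(* The projection adds [x_a] times the radial contraction, which [sum_x_EL] evaluates to minus the
   divergence. *)
have proj_eq x A a : deSitter x ->
    \sum_(b < 5) theta x a b * (eta5 R b * field_expr K A b x) =
    field_expr K A a x - xlow x a * divT (K A) x.
  move=> xS; transitivity (\sum_b eta5 R b * theta x a b * EL_field (K A) b x).
    by apply: eq_bigr => b _; rewrite /field_expr /EL_field; ring.
  by rewrite sum_theta sum_x_EL ?mulrN//; exact: hT.
have part1 : linear_field_equation f q K <->
    (forall x, deSitter x -> forall A a,
       \sum_(b < 5) theta x a b * (eta5 R b * field_expr K A b x) = 0).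
  have proj_lower x B a : \sum_b eta5 R b * theta x a b * EL_field (lower_index q K B) b x
      = \sum_A M A B * \sum_b theta x a b * (eta5 R b * field_expr K A b x).
    under [RHS]eq_bigr do rewrite mulr_sumr.
    rewrite exchange_big/=; apply: eq_bigr => b _.
    rewrite EL_lower// mulr_sumr; apply: eq_bigr => A _.
    rewrite -[EL_field (K A) b x]/(field_expr K A b x) -/M.
    move: (field_expr _ _ _ _) (theta _ _ _) => *; ring.
  (* A transverse variation equals its own projection, so [theta] can be moved from it onto the
     Euler-Lagrange expression. *)
  have pairing_proj (dK : gauge_field R) x : deSitter x -> transverse dK ->
      EL_pairing q K dK x = \sum_B \sum_a eta5 R a * dK B a x *
        \sum_b eta5 R b * theta x a b * EL_field (lower_index q K B) b x.
    move=> xS dKt; apply: eq_bigr => B _.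
    transitivity (\sum_a \sum_b eta5 R a * dK B a x *
        (eta5 R b * theta x a b * EL_field (lower_index q K B) b x)).
      rewrite exchange_big/=; apply: eq_bigr => b _.
      rewrite -[dK B b x in LHS](@sum_theta_transverse _ (dK B) _ x b xS); last first.
        by move=> y yS; exact: dKt.
      rewrite !mulr_sumr; apply: eq_bigr => a _; rewrite (theta_sym x b a).
      move: (EL_field _ _ _) (theta _ _ _) => *; ring.
    by apply: eq_bigr => a _; rewrite mulr_sumr.
  split=> [lin x xS A a|proj dK [dKs dKtr [r Hr]]]; last first.
    have dKt A a : test_function (dK A a).
      by split; [exact: dKs|exists r => x xS rx; exact: Hr].
    have := is_derive_first_variation f q hKs dKt.
    rewrite dS_integral_pairing// (@dS_integral_eq _ _ (fun=> 0)) ?dS_integral0 ?mulr0//.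
    move=> x xS; rewrite pairing_proj// big1// => B _; rewrite big1// => a _.
    by rewrite proj_lower big1 ?mulr0// => A _; rewrite proj ?mulr0.
  pose W B a x := \sum_b eta5 R b * theta x a b * EL_field (lower_index q K B) b x.
  have Ws B b : smooth (W B b).
    apply: smooth_sum => c; apply: smoothM.
      by apply: smoothM; [exact: smooth_cst|exact: smooth_theta].
    exact: (smooth_field_expr B c (smooth_lower_index q hKs)).
  have W0 B : W B a x = 0.
    (* Chosen so that the cutoff is positive at the point [x] under test. *)
    pose r := \sum_b x 0 b ^+ 2 + 1.
    have xr : \sum_b x 0 b ^+ 2 < r by rewrite ltrDl.
    have r0 : 0 < r by rewrite ltr_wpDl// sumr_ge0// => b _; exact: sqr_ge0.
    (* Row [a] of [theta] makes this variation transverse, and its pairing with the equation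
       produces a second factor [W B a]: the integrand is a square times the nonnegative cutoff. *)
    pose dK : gauge_field R := fun C b y =>
      (C == B)%:R * theta y b a * W B a y * cutoff r y.
    have bt : test_function (@cutoff R r).
      by split; [exact: smooth_cutoff|exists (r + 1) => y _; exact: cutoff_eq0].
    have dKt C b : test_function (dK C b).
      apply: test_functionMl bt; apply: smoothM => //; apply: smoothM.
        exact: smooth_cst.
      exact: smooth_theta.
    have dKtr : transverse dK.
      move=> y yS C.
      transitivity ((C == B)%:R * W B a y * cutoff r y * \sum_b y 0 b * theta y a b).
        rewrite mulr_sumr; apply: eq_bigr => b _; rewrite /dK (theta_sym y b a).
        move: (W B a y) (theta _ _ _) (cutoff r y) => *; ring.
      by rewrite sum_x_theta// mulr0.
    have adm : admissible_variation dK.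
      split => //; first by move=> C b; exact: (dKt C b).1.
      exists (r + 1) => y yS ry C b; rewrite /dK cutoff_eq0 ?mulr0//.
    have d1 := is_derive_first_variation f q hKs dKt.
    have := @derive_val _ _ _ _ _ _ _ d1; rewrite (@derive_val _ _ _ _ _ _ _ (lin _ adm)).
    rewrite dS_integral_pairing// => /esym/eqP; rewrite mulf_eq0 oppr_eq0 pnatr_eq0/=.
    have pE y : deSitter y -> EL_pairing q K dK y = W B a y * W B a y * cutoff r y.
      move=> yS; rewrite /EL_pairing (bigD1 B)//= [X in _ + X]big1 ?addr0; last first.
        move=> C /negbTE CB; rewrite big1// => b _.
        by rewrite /dK CB !mul0r !mulr0.
      rewrite {1}/W !mulr_suml; apply: eq_bigr => b _.
      rewrite /dK eqxx mul1r (theta_sym y b a).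
      move: (EL_field _ _ _) (theta _ _ _) (W B a y) (cutoff r y) => *; ring.
    move=> /eqP I0.
    have := dS_integral_eq0 (EL_pairing_test q hKs dKt) _ I0 xS.
    rewrite pE// => /(_ _)/eqP.
    rewrite !mulf_eq0 (gt_eqF (cutoff_gt0 xr)) orbF orbb => H.
    apply/eqP/H => y yS; rewrite pE// mulr_ge0 ?cutoff_ge0// -expr2; exact: sqr_ge0.
  (* Vanishing for every lowered index [B] is a homogeneous linear system with matrix [q + q^T],
     which is then inverted. *)
  have row0 : (\row_A' \sum_b theta x a b * (eta5 R b * field_expr K A' b x)) *m M = 0.
    apply/rowP => B; rewrite !mxE -[RHS](W0 B) /W proj_lower.
    by apply: eq_bigr => A' _; rewrite mxE mulrC.
  have := congr1 (mulmx^~ (invmx M)) row0.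
  rewrite mulmxK// mul0mx => /rowP/(_ A).
  by rewrite !mxE.
split => //.
(* The ambient equation is the projected one together with its radial part, which is minus the
   divergence. *)
- split=> [E|[lin div] x xS A a].
    have E1 x A a : deSitter x ->
        \sum_(b < 5) theta x a b * (eta5 R b * field_expr K A b x) = 0.
      by move=> xS; rewrite big1// => b _; rewrite E// !mulr0.
    split; first by apply/part1 => x xS A a; exact: E1.
    move=> x xS A; apply/eqP; rewrite -oppr_eq0; apply/eqP.
    rewrite -(sum_x_EL (hKs A) (hT A) xS) big1// => b _.
    by rewrite -[EL_field _ _ _]/(field_expr K A b x) E// mulr0.
  have := part1.1 lin x xS A a.
  by rewrite proj_eq// div// mulr0 subr0.
- move=> div.
  (* [divT (K A)] vanishes only on the hyperboloid, but [dT] is tangential, so its transverse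
     derivative vanishes there too. *)
  have E x A a : deSitter x -> field_expr K A a x = - (Q0 (K A a) x - 2 * K A a x).
    move=> xS; rewrite /field_expr div// (@dT_eq0 _ (divT (K A)))//; last first.
    - by move=> y yS; exact: div.
    - by apply: smooth_divT => b; exact: hKs.
    move: (Q0 _ _) => *; ring.
  split=> H x xS A a.
    by have := H x xS A a; rewrite E// => /eqP; rewrite oppr_eq0 => /eqP.
  by rewrite E// H// oppr0.
Qed.
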